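(* Let $(V,(\alpha_s)_{s\in S},(\alpha_s^\vee)_{s\in S})$ be a linear Coxeter system with Coxeter group $\mathcal{W}$, fundamental chamber $K$ and Tits cone $\mathcal{T} = \mathcal{W}K$. For every $v \in \mathcal{T}$, $$\overline{\mathrm{co}}(v) \cap \mathcal{T} = \mathcal{T} \cap \bigcap_{w \in \mathcal{W}} w(v - \overline{C_v}).$$ If $v \in \mathcal{T}^0$ (the interior of $\mathcal{T}$), then $C_v$ is closed, $\overline{\mathrm{co}}(v) \subseteq \mathcal{T}^0$, and $$\overline{\mathrm{co}}(v) = \mathcal{T} \cap \bigcap_{w \in \mathcal{W}} w(v - C_v) = \mathcal{T} \cap \bigcap_{w \in \mathcal{W}} w(v - C_S).$$
   Context: Let $V$ be a finite-dimensional real vector space. A reflection data on $V$ consists of a finite family $(\alpha_s)_{s\in S}$ in $V^*$ and a family $(\alpha_s^\vee)_{s\in S}$ in $V$ with $\alpha_s(\alpha_s^\vee)=2$. Put $r_s(v) := v - \alpha_s(v)\alpha_s^\vee$, $\mathcal{W} := \langle r_s : s \in S\rangle \subseteq \mathrm{GL}(V)$ and $K := \{v \in V : \alpha_s(v)\ge 0 \text{ for all } s \in S\}$. It is a linear Coxeter system if: (1) $K$ has non-empty interior $K^0$; (2) for each $s \in S$, $\alpha_s$ is not in the convex cone generated by $\{\alpha_t : t \ne s\}$; (3) $wK^0\cap K^0=\emptyset$ for all $w \in \mathcal{W}\setminus\{e\}$. The Tits cone $\mathcal{T}:=\mathcal{W}K$ is a convex cone. The group $\mathcal{W}$ acts on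 $V^*$ by $(w\alpha)(v)=\alpha(w^{-1}v)$. Roots are the elements of $\Delta := \mathcal{W}\{\alpha_s : s\in S\}\subseteq V^*$; for $\alpha = w\alpha_s\in\Delta$ the coroot is $\alpha^\vee := w\alpha_s^\vee$ (well defined), so that $v \mapsto v-\alpha(v)\alpha^\vee$ is the reflection $w r_s w^{-1}$. For $v\in V$: $C_v$ is the convex cone generated by $\{\alpha^\vee : \alpha\in\Delta,\ \alpha(v)>0\}$; $C_S$ is the convex cone generated by $\{\alpha_s^\vee : s\in S\}$ (convex cones generated by a set consist of finite non-negative linear combinations, and contain $0$); $\overline{\mathrm{co}}(v)$ is the closed convex hull of the orbit $\mathcal{W}v$.
   Formalization: The last equality, with C_S, is false for v outside K (V = ℝ, W = {±1}, v = −1: the right side is empty); it is stated with v on the right replaced by any point uv, u in W, of its orbit lying in K, which for v in K includes the printed formula. *)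

(* Defs.v *)
From HB Require Import structures.
From mathcomp Require Import all_boot all_order all_algebra.
From mathcomp Require Import all_classical all_reals all_analysis.

Set Implicit Arguments.
Unset Strict Implicit.
Unset Printing Implicit Defensive.

Import Order.TTheory GRing.Theory Num.Theory.
Import numFieldNormedType.Exports.

Local Open Scope classical_set_scope.
Local Open Scope ring_scope.

(* The vector space topology of a finite-dimensional space: the topology of   *)
(* coordinates in a basis. It does not depend on the basis.                   *)
Section Topology.
Variables (R : realType) (V : vectType R).

Definition vspace_top : topologicalType :=
  initial_topology (passmx.rVof (vbasis {:V}) : V -> 'rV[R]_(\dim {:V})).

Definition vclosure (A : set V) : set V := closure (A : set vspace_top).
Definition vinterior (A : set V) : set V := interior (A : set vspace_top).
Definition vclosed (A : set V) : Prop := closed (A : set vspace_top).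

End Topology.

Section Convexity.
Variables (R : realType).

Definition cone_hull (U : lmodType R) (X : set U) : set U :=
  [set x | exists (n : nat) (c : 'I_n -> R) (u : 'I_n -> U),
     (forall i, 0 <= c i /\ X (u i)) /\ x = \sum_(i < n) c i *: u i].

Definition closed_convex_hull (V : vectType R) (A : set V) : set V :=
  smallest [set C : set V | vclosed C /\ @convex_set R V C] A.

End Convexity.

Section Reflection.
Variables (R : realType) (V : vectType R).

Definition reflection_fun (a : 'Hom(V, R^o)) (c : V) (v : V) : V :=
  v - (a v : R) *: c.

Lemma reflection_fun_is_linear a c : linear (reflection_fun a c).
Proof.
move=> k x y; rewrite /reflection_fun linearP scalerDl scalerBr -scalerA.
by rewrite opprD addrACA.
Qed.

HB.instance Definition _ a c := GRing.isLinear.Build R V V *:%R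
  (reflection_fun a c) (reflection_fun_is_linear a c).

Definition reflection (a : 'Hom(V, R^o)) (c : V) : 'End(V) :=
  linfun (reflection_fun a c).

Lemma reflectionE a c v : reflection a c v = v - (a v : R) *: c.
Proof. by rewrite lfunE. Qed.

End Reflection.

Record reflection_data (R : realType) (V : vectType R) (S : finType) :=
  ReflectionData {
    sroot : S -> 'Hom(V, R^o);
    scoroot : S -> V;
    sroot_scoroot : forall s : S, sroot s (scoroot s) = 2 }.

Section CoxeterSystem.
Variables (R : realType) (V : vectType R) (S : finType).
Variable D : reflection_data V S.

Definition srefl (s : S) : 'End(V) := reflection (sroot D s) (scoroot D s).

(* All elements of W are invertible, so ^-1 on 'End(V) is the group inverse.  *)
Inductive W : set 'End(V) :=
| W_one : W \1%VF
| W_refl s : W (srefl s)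
| W_comp f g : W f -> W g -> W (f \o g)%VF
| W_inv f : W f -> W (f^-1)%VF.

Definition K : set V := [set v | forall s : S, 0 <= (sroot D s v : R)].

Definition linear_coxeter_system : Prop :=
  [/\ vinterior K !=set0,
      forall s : S, ~ cone_hull [set sroot D t | t in [set t | t <> s]] (sroot D s)
    & forall w : 'End(V), W w -> w <> \1%VF ->
        [set w x | x in vinterior K] `&` vinterior K = set0].

Definition tits_cone : set V := \bigcup_(w in W) [set w x | x in K].

Definition dual_act (w : 'End(V)) (a : 'Hom(V, R^o)) : 'Hom(V, R^o) :=
  (a \o w^-1)%VF.

Definition is_root (a : 'Hom(V, R^o)) : Prop :=
  exists2 w, W w & exists s : S, a = dual_act w (sroot D s).

(* The coroot map as a relation between roots and vectors: every root has a   *)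
(* coroot, unique in a linear Coxeter system.                                 *)
Definition is_coroot (a : 'Hom(V, R^o)) (c : V) : Prop :=
  exists2 w, W w &
    exists s : S, a = dual_act w (sroot D s) /\ c = w (scoroot D s).

Definition coroot_cone (v : V) : set V :=
  cone_hull [set c | exists a : 'Hom(V, R^o),
    [/\ is_root a, is_coroot a c & 0 < (a v : R)]].

Definition simple_coroot_cone : set V := cone_hull (range (scoroot D)).

Definition orbit_hull (v : V) : set V :=
  closed_convex_hull [set w v | w in W].

(* The intersection over w in W of the sets w (x - C).                        *)
Definition bigcap_translates (x : V) (C : set V) : set V :=
  \bigcap_(w in W) [set w (x - c) | c in C].

End CoxeterSystem.

(* Main.v *)
Require Import Defs.
From HB Require Import structures.
From mathcomp Require Import all_boot all_order all_algebra.
From mathcomp Require Import all_classical all_reals all_analysis.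
From mathcomp Require Import perm ring lra.

(** Fix a point p in the interior of K. No root vanishes on the orbit of p,
    since its reflection would fix an interior point of a chamber; so the sign
    of a (w p) tells on which side of the wall of a the chamber w K lies. The
    walls adjacent to K are those of the simple roots ([wall_root]), and from
    this follow the exchange condition ([exchange]), the finiteness of the
    number of walls between two chambers ([inversions_finite]) and the
    convexity of the Tits cone T ([tits_convex_cone]).

    For v in K the differences v - w v lie in C_v, by induction on a word for
    w ([orbit_sub_cone]). Hence the hull co(v) is contained in each w(v - cl
    C_v), as all these sets are closed and convex and the orbit is invariant.
    For the converse, both sides are W-invariant, and it suffices to show that
    a point x of K with k - x in cl C_k, for some k in K, lies in co(k)
    ([dominated_in_hull]). Start at a point y of co(k) close to k and in the
    relative interior of the hull and move towards x. At every point z on the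
    way the roots positive at k are still positive, so co(k) contains a
    segment from z in the direction of minus each of their coroots; therefore
    it contains a segment towards x. As co(k) is closed, x is reached.

    Let now v be interior to T. Its stabilizer is finite, hence C_v is
    finitely generated ([coroot_coneE]) and closed. That co(v) stays in the
    interior of T is a matter of volume: a point of co(v) outside the interior
    would have a functional f, nonzero and nonnegative on T, that is
    nonpositive there. Choose a basis f_1 = f, f_2, ..., f_m of the span of
    the W-orbit of f inside this orbit. The group acts on that span with
    determinant 1 or -1, and a functional nonnegative on T is bounded by its
    value at v, so the product of the f_i is bounded below by a positive
    constant on the orbit of v ([orbit_product_bounded]). Then so are,
    uniformly, the linear combinations of the f_i whose positive coefficients
    have product 1, and this contradicts that f is nonpositive at a point of
    the hull ([orbit_functional_positive]).

    Finally C_k is contained in C_S for k in K, and C_S may replace C_k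
    because the intersection of the translates of C_S under the stabilizer of
    k is contained in C_k when k is interior to T ([simple_cone_intersection],
    through the Farkas lemma). *)

Set Implicit Arguments.
Unset Strict Implicit.
Unset Printing Implicit Defensive.

Import Order.TTheory GRing.Theory Num.Theory.
Import numFieldNormedType.Exports.

Local Open Scope classical_set_scope.
Local Open Scope ring_scope.

(** * Linear functionals and bases *)

Section Functionals.
Variables (R : realType) (V : vectType R).
Implicit Types (f g : 'Hom(V, R^o)) (x y : V) (k : R).

Lemma functionalD f x y : (f (x + y) : R) = (f x : R) + f y.
Proof. exact: linearD. Qed.

Lemma functionalN f x : (f (- x) : R) = - (f x : R).
Proof. exact: linearN. Qed.

Lemma functionalB f x y : (f (x - y) : R) = (f x : R) - f y.
Proof. exact: linearB. Qed.

Lemma functionalZ f k x : (f (k *: x) : R) = k * (f x : R).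
Proof. exact: linearZ. Qed.

Lemma functional_sum f (I : Type) (r : seq I) (F : I -> V) :
  (f (\sum_(i <- r) F i) : R) = \sum_(i <- r) (f (F i) : R).
Proof. exact: linear_sum. Qed.

Lemma functional_addE f g x : ((f + g) x : R) = (f x : R) + g x.
Proof. exact: add_lfunE. Qed.

Lemma functional_scaleE k f x : ((k *: f) x : R) = k * (f x : R).
Proof. exact: scale_lfunE. Qed.

Lemma functional_sumE (I : Type) (r : seq I) (F : I -> 'Hom(V, R^o)) x :
  ((\sum_(i <- r) F i) x : R) = \sum_(i <- r) (F i x : R).
Proof. exact: sum_lfunE. Qed.

End Functionals.

Section SpanningSubset.
Variables (R : realType) (V : vectType R).

(** Bases of a span can be chosen inside the spanning set, which here is a set
    of coroots or an orbit of functionals. *)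
Lemma free_subset_span (X : set V) (l0 : seq V) : free l0 ->
  (forall x, x \in l0 -> X x) ->
  exists l, [/\ free l, {subset l0 <= l}, forall x, x \in l -> X x
    & forall x, X x -> x \in << l >>%VS].
Proof.
(* Adjoin elements of X until they span; the dimension bounds their number. *)
have [n] := ubnP (\dim {:V} - size l0); elim: n l0 => // n ih l0 ln free0 X0.
have [full|/existsNP[x /not_implyP[Xx /negP xl]]] := pselect (forall x, X x -> x \in << l0 >>%VS).
  by exists l0; split=> //.
have [|||l [fl sl Xl spanl]] := ih (x :: l0).
- have : (size (x :: l0) <= \dim {:V})%N.
    have/eqP <- : free (x :: l0) by rewrite free_cons xl.
    exact: dimvS (subvf _).
  move: ln; rewrite /= ltnS => ln sx; rewrite subnS; apply: leq_trans ln.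
  by rewrite ltn_predL subn_gt0.
- by rewrite free_cons xl.
- by move=> y; rewrite inE => /orP[/eqP ->|/X0].
- by exists l; split=> // y yl; apply: sl; rewrite inE yl orbT.
Qed.

End SpanningSubset.

(** * The topology of a finite-dimensional space *)

Section CoordinateNorm.
Variables (R : realType).
Implicit Type V : vectType R.

(** The topology of V is that of the coordinates in a basis; this norm gives
    it an epsilon description. *)
Definition cnorm V (x : V) : R := \sum_i `|coord (vbasis {:V}) i x|.

Lemma cnorm_ge0 V (x : V) : 0 <= cnorm x.
Proof. by apply: sumr_ge0. Qed.

Lemma cnorm0 V : cnorm (0 : V) = 0.
Proof. by rewrite /cnorm big1 // => i _; rewrite linear0 normr0. Qed.

Lemma ler_cnormD V (x y : V) : cnorm (x + y) <= cnorm x + cnorm y.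
Proof.
rewrite /cnorm -big_split /=; apply: ler_sum => i _.
by rewrite linearD ler_normD.
Qed.

Lemma cnormZ V (k : R) (x : V) : cnorm (k *: x) = `|k| * cnorm x.
Proof.
by rewrite /cnorm mulr_sumr; apply: eq_bigr => i _; rewrite linearZ /= normrM.
Qed.

Lemma cnormN V (x : V) : cnorm (- x) = cnorm x.
Proof. by rewrite -scaleN1r cnormZ normrN1 mul1r. Qed.

Lemma ler_cnorm_sum V (I : Type) (r : seq I) (F : I -> V) :
  cnorm (\sum_(i <- r) F i) <= \sum_(i <- r) cnorm (F i).
Proof.
elim: r => [|i r ih]; first by rewrite !big_nil cnorm0.
by rewrite !big_cons (le_trans (ler_cnormD _ _)) // lerD2l.
Qed.

Lemma cnorm_coord V (x : V) :
  x = \sum_i coord (vbasis {:V}) i x *: (vbasis {:V})`_i.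
Proof. by rewrite -coord_vbasis // memvf. Qed.

Lemma linear_bounded V (U : vectType R) (f : 'Hom(V, U)) :
  exists2 M : R, 0 < M & forall x, cnorm (f x) <= M * cnorm x.
Proof.
exists (1 + \sum_(i < \dim {:V}) cnorm (f ((vbasis {:V})`_i))) => [|x].
  by rewrite ltr_pwDl // sumr_ge0 // => i _; exact: cnorm_ge0.
rewrite {1}(cnorm_coord x) linear_sum /= mulrDl mul1r.
rewrite (le_trans (ler_cnorm_sum _ _)) // -[leLHS]add0r lerD ?cnorm_ge0 //.
rewrite mulr_suml; apply: ler_sum => i _; rewrite linearZ /= cnormZ mulrC.
rewrite ler_wpM2l ?cnorm_ge0 // /cnorm (bigD1 i) //= lerDl sumr_ge0 //.
Qed.

Lemma functional_bounded V (f : 'Hom(V, R^o)) :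
  exists2 M : R, 0 < M & forall x, `|f x : R| <= M * cnorm x.
Proof.
exists (1 + \sum_(i < \dim {:V}) `|f ((vbasis {:V})`_i) : R|) => [|x].
  by rewrite ltr_pwDl // sumr_ge0.
rewrite {1}(cnorm_coord x) linear_sum /= mulrDl mul1r.
rewrite (le_trans (ler_norm_sum _ _ _)) // -[leLHS]add0r lerD ?cnorm_ge0 //.
rewrite mulr_suml; apply: ler_sum => i _.
rewrite linearZ /= [_ *: _]/(_ * _) normrM mulrC.
rewrite ler_wpM2l // /cnorm (bigD1 i) //= lerDl sumr_ge0 //.
Qed.

Lemma nbhs_cnormP V (A : set V) (x : V) :
  nbhs (x : vspace_top V) (A : set (vspace_top V)) <->
  exists2 e : R, 0 < e & forall y, cnorm (y - x) < e -> A y.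
Proof.
split.
  case=> B /= [[C Cop <-] /= Cx CA].
  have /nbhs_ballP[e /= e0 eC] : nbhs (passmx.rVof (vbasis {:V}) x) C.
    exact: open_nbhs_nbhs.
  exists e => // y yx; apply: CA => /=; apply: eC.
  split=> // i j; rewrite !mxE /ball /= distrC -linearB.
  by apply: le_lt_trans yx; rewrite /cnorm (bigD1 j) //= lerDl sumr_ge0.
case=> e e0 eA; pose d := \dim {:V}.
have: nbhs (passmx.rVof (vbasis {:V}) x)
    (ball (passmx.rVof (vbasis {:V}) x) (e / (d%:R + 1))).
  by apply: nbhsx_ballx; rewrite divr_gt0 // ltr_pwDr.
move=> /(@initial_continuous V _ (passmx.rVof (vbasis {:V})) x) xnear.
apply: (@filterS _ (nbhs (x : vspace_top V)) _ _ _ _ xnear).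
move=> y /= [_ yx]; apply: eA.
have := yx 0; move=> {}yx.
have d1 : 0 < d%:R + 1 :> R by rewrite ltr_pwDr.
apply: (@le_lt_trans _ _ (\sum_(i < d) (e / (d%:R + 1)))).
  apply: ler_sum => i _; have := yx i; rewrite /ball /= !mxE distrC -linearB.
  by move/ltW.
rewrite sumr_const card_ord -[_ *+ _]mulr_natr -mulrA gtr_pMr //.
by rewrite mulrC ltr_pdivrMr // mul1r ltrDl.
Qed.

Lemma vclosureP V (A : set V) x :
  vclosure A x <-> forall e : R, 0 < e -> exists2 y, A y & cnorm (y - x) < e.
Proof.
split=> [Ax e e0|Ax B /nbhs_cnormP[e e0 eB]].
  have [|y [Ay yx]] := Ax [set y | cnorm (y - x) < e]; last by exists y.
  by apply/nbhs_cnormP; exists e.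
by have [y Ay yx] := Ax e e0; exists y; split=> //; exact: eB.
Qed.

Lemma vinteriorP V (A : set V) x :
  vinterior A x <-> exists2 e : R, 0 < e & forall y, cnorm (y - x) < e -> A y.
Proof. exact: nbhs_cnormP. Qed.

Lemma vclosedP V (A : set V) :
  vclosed A <-> forall x,
    (forall e : R, 0 < e -> exists2 y, A y & cnorm (y - x) < e) -> A x.
Proof.
split=> [Ac x /vclosureP|Ac x /vclosureP]; first exact: Ac.
exact: Ac.
Qed.

Lemma sub_vclosure V (A : set V) : A `<=` vclosure A.
Proof.
by move=> x Ax; apply/vclosureP => e e0; exists x; rewrite ?subrr ?cnorm0.
Qed.

Lemma vinterior_sub V (A : set V) : vinterior A `<=` A.
Proof. by move=> x /vinteriorP[e e0]; apply; rewrite subrr cnorm0. Qed.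

Lemma closed_vclosure V (A : set V) : vclosed (vclosure A).
Proof.
apply/vclosedP => x clx; apply/vclosureP => e e0.
have e2 : 0 < e / 2 by rewrite divr_gt0.
have [y /vclosureP/(_ _ e2)[z Az zy] yx] := clx _ e2.
exists z => //; rewrite -(subrK y z) -addrA (le_lt_trans (ler_cnormD _ _)) //.
by rewrite [e]splitr ltrD.
Qed.

Lemma vclosed_id V (A : set V) : vclosed A -> vclosure A = A.
Proof. by move=> cA; apply/seteqP; split; [exact: cA|exact: sub_vclosure]. Qed.

Lemma vclosed_preimage V (U : vectType R) (f : 'Hom(V, U)) (c : U) (A : set U) :
  vclosed A -> vclosed [set x | A (c + f x)].
Proof.
move=> /vclosedP cA; apply/vclosedP => x clx /=; apply: cA => e e0.
have [M M0 Mf] := linear_bounded f.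
have [|y /= Ay yx] := clx (e / M); first by rewrite divr_gt0.
exists (c + f y) => //; rewrite opprD addrACA subrr add0r -linearB.
by rewrite (le_lt_trans (Mf _)) // mulrC -ltr_pdivlMr.
Qed.

Lemma vclosed_le V (f : 'Hom(V, R^o)) (c : R) : vclosed [set x | c <= (f x : R)].
Proof.
apply/vclosedP => x clx /=; rewrite leNgt; apply/negP => fc.
have [M M0 Mf] := functional_bounded f.
have [|y /= cy yx] := clx ((c - f x) / M); first by rewrite divr_gt0 // subr_gt0.
have: `|f (y - x) : R| < c - f x.
  by rewrite (le_lt_trans (Mf _)) // mulrC -ltr_pdivlMr.
by rewrite linearB /= ltr_norml => /andP[_]; rewrite ltrD2r ltNge cy.
Qed.

End CoordinateNorm.

Lemma small_perturbation (R : realType) (I : eqType) (l : seq I) (f g : I -> R) :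
  (forall i, i \in l -> 0 < f i) ->
  exists2 e : R, 0 < e & forall e', 0 <= e' -> e' <= e ->
    forall i, i \in l -> 0 < f i + e' * g i.
Proof.
elim: l => [|i l ih] fl; first by exists 1.
have [|e e0 el] := ih; first by move=> j jl; apply: fl; rewrite inE jl orbT.
have fi : 0 < f i by apply: fl; rewrite inE eqxx.
have g0 : 0 < `|g i| + 1 by rewrite ltr_pwDr.
exists (Num.min e (f i / (`|g i| + 1))); first by rewrite lt_min e0 divr_gt0.
move=> e' e'0; rewrite le_min => /andP[e'e e'g] j; rewrite inE => /orP[/eqP ->|]; last first.
  exact: el.
move: e'g; rewrite ler_pdivlMr // mulrDr mulr1 => e'g.
have := ler_norm (- (e' * g i)); rewrite normrN normrM (ger0_norm e'0) => gn.
have [e'1|e'1] := eqVneq e' 0; first by rewrite e'1 mul0r addr0.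
have : 0 < e' by rewrite lt_def e'1.
lra.
Qed.

Section SmallVectors.
Variables (R : realType) (V : vectType R).
Implicit Types (A C : set V) (x d : V).

Lemma cnorm_eq0 x : cnorm x = 0 -> x = 0.
Proof.
move=> x0; rewrite (cnorm_coord x) big1 // => i _.
have := x0; rewrite /cnorm => /eqP; rewrite psumr_eq0 // => /allP/(_ i).
by rewrite mem_index_enum => /(_ isT)/eqP/normr0_eq0 ->; rewrite scale0r.
Qed.

Lemma small_vectors (I : eqType) (l : seq I) (f : I -> 'Hom(V, R^o)) (b : I -> R) :
  (forall i, i \in l -> 0 < b i) ->
  exists2 e : R, 0 < e & forall x, cnorm x < e -> forall i, i \in l -> `|f i x : R| < b i.
Proof.
move=> b0.
have bound i : exists2 M : R, 0 < M & forall y, `|f i y : R| <= M * cnorm y.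
  exact: functional_bounded.
pose M i := sval (cid2 (bound i)).
have [e e0 ex] := small_perturbation (fun i => - M i) b0.
exists e => // x xe i il.
have := ex e (ltW e0) (lexx _) i il.
rewrite /M; case: cid2 => /= m m0 /(_ x) fx.
have : m * cnorm x <= m * e by rewrite ler_pM2l // ltW.
by lra.
Qed.

Lemma vclosed_vspace (U : {vspace V}) : vclosed [set x | x \in U].
Proof.
apply/vclosedP => x clx /=; pose f : 'End(V) := (\1 - projv U)%VF.
have fU y : y \in U -> f y = 0.
  by move=> yU; rewrite add_lfunE opp_lfunE id_lfunE projv_id // subrr.
suff fx : f x = 0.
  move: fx; rewrite add_lfunE opp_lfunE id_lfunE => /subr0_eq ->.
  exact: memv_proj.
apply: cnorm_eq0; apply/eqP; rewrite eq_le cnorm_ge0 andbT leNgt; apply/negP => fx.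
have [M M0 Mf] := linear_bounded f.
have [|y /= yU yx] := clx (cnorm (f x) / M); first by rewrite divr_gt0.
have := Mf (y - x); rewrite linearB /= (fU y yU) sub0r cnormN.
by rewrite leNgt mulrC -ltr_pdivlMr // yx.
Qed.

Lemma vclosure_image (f : 'End(V)) A C x : (forall y, A y -> C (f y)) ->
  vclosure A x -> vclosure C (f x).
Proof.
move=> AC /vclosureP Ax; apply/vclosureP => e e0.
have [M M0 Mf] := linear_bounded f.
have [|y Ay yx] := Ax (e / M); first by rewrite divr_gt0.
exists (f y); first exact: AC.
by rewrite -linearB (le_lt_trans (Mf _)) // mulrC -ltr_pdivlMr.
Qed.

Lemma interior_feasible A x d :
  vinterior A x -> exists2 e : R, 0 < e & A (x + e *: d).
Proof.
move=> /vinteriorP[e e0 eA].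
have d0 : 0 < cnorm d + 1 by rewrite ltr_wpDl ?cnorm_ge0.
exists (e / (cnorm d + 1) / 2); first by rewrite !divr_gt0.
apply: eA; rewrite addrAC subrr add0r cnormZ gtr0_norm ?divr_gt0 //.
have ed : 0 < e / (cnorm d + 1) by rewrite divr_gt0.
have : e / (cnorm d + 1) * (cnorm d + 1) = e by rewrite divfK ?gt_eqF.
have := cnorm_ge0 d; nra.
Qed.

End SmallVectors.

(** * Convex sets and cones *)

Section ConvexSets.
Variables (R : realType) (V : vectType R).
Implicit Types (A C Q : set V) (x y z d : V).

Lemma convex_setP A : @convex_set R V A <->
  forall x y (t : R), 0 <= t -> t <= 1 -> A x -> A y -> A (t *: x + (1 - t) *: y).
Proof.
split=> [cA x y t t0 t1 Ax Ay|cA x y l].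
  by apply/set_mem; apply: (cA x y (Itv01 t0 t1)); apply/mem_set.
rewrite !inE => Ax Ay.
exact: (cA x y l%:num (ge0 l) (le1 l) Ax Ay).
Qed.

(** Subconvex weights are enough because x itself absorbs the missing mass. *)
Lemma convex_combination A n (c : 'I_n -> R) (u : 'I_n -> V) x :
  @convex_set R V A -> A x -> (forall i, 0 <= c i) -> \sum_i c i <= 1 ->
  (forall i, A (x + u i)) -> A (x + \sum_i c i *: u i).
Proof.
move=> /convex_setP cA Ax; elim: n c u => [|n ih] c u c0 c1 Au.
  by rewrite big_ord0 addr0.
move: c1; rewrite !big_ord_recr /=; set t := c ord_max => c1.
have s0 : 0 <= \sum_(i < n) c (widen_ord (leqnSn n) i) by exact: sumr_ge0.
have t0 : 0 <= t by exact: c0.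
have [t1|] := ltP t 1; last first.
  move=> t1; have s00 : \sum_(i < n) c (widen_ord (leqnSn n) i) = 0 by lra.
  have -> : t = 1 by lra.
  rewrite big1 ?add0r ?scale1r //.
  by move=> i _; move/psumr_eq0P: s00 => -> //; rewrite scale0r.
have t1' : 1 - t != 0 by lra.
have IH : A (x + \sum_(i < n) (c (widen_ord (leqnSn n) i) / (1 - t))
    *: u (widen_ord (leqnSn n) i)).
  apply: ih => [i||i]; last exact: Au.
    by rewrite divr_ge0 // subr_ge0 ltW.
  by rewrite -mulr_suml ler_pdivrMr ?subr_gt0 // mul1r; lra.
have := cA _ _ _ t0 (ltW t1) (Au ord_max) IH; congr (A _).
rewrite !scalerDr scaler_sumr addrACA -scalerDl subrKC scale1r.
rewrite [t *: _ + _]addrC; congr (_ + (_ + _)); apply: eq_bigr => i _.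
by rewrite scalerA; congr (_ *: _); field.
Qed.

Lemma hull_sub A : A `<=` closed_convex_hull A.
Proof. exact: sub_gen_smallest. Qed.

Lemma hull_min A C : vclosed C -> @convex_set R V C -> A `<=` C ->
  closed_convex_hull A `<=` C.
Proof. by move=> clC cC AC; apply: smallest_sub. Qed.

Lemma hull_convex A : @convex_set R V (closed_convex_hull A).
Proof.
apply/convex_setP => x y t t0 t1 Ax Ay C [[clC cC] AC].
by move/convex_setP: (cC); apply => //; [apply: Ax|apply: Ay].
Qed.

Lemma hull_closed A : vclosed (closed_convex_hull A).
Proof.
apply/vclosedP => x clx C [[clC cC] AC]; move/vclosedP: (clC); apply => e e0.
by have [y Ay ?] := clx e e0; exists y => //; apply: Ay.
Qed.

Lemma convex_halfspace (f : 'Hom(V, R^o)) (c : R) :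
  @convex_set R V [set x | c <= (f x : R)].
Proof.
apply/convex_setP => x y t t0 t1 /= cx cy.
rewrite linearD !linearZ /= -[c](_ : t * c + (1 - t) * c = c); last by lra.
by rewrite lerD // ler_wpM2l // subr_ge0.
Qed.

Lemma convex_preimage (f : 'End(V)) (c : V) A :
  @convex_set R V A -> @convex_set R V [set x | A (c + f x)].
Proof.
move=> /convex_setP cA; apply/convex_setP => x y t t0 t1 /= Ax Ay.
rewrite linearD !linearZ /=.
have := cA _ _ _ t0 t1 Ax Ay; congr (A _).
by rewrite !scalerDr addrACA -scalerDl subrKC scale1r.
Qed.

Definition convex_cone C :=
  [/\ C 0, forall x y, C x -> C y -> C (x + y)
    & forall (k : R) x, 0 <= k -> C x -> C (k *: x)].

Lemma convex_cone_sum C n (c : 'I_n -> R) (u : 'I_n -> V) : convex_cone C ->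
  (forall i, 0 <= c i) -> (forall i, C (u i)) -> C (\sum_i c i *: u i).
Proof.
move=> [C0 CD CZ] c0 Cu.
by apply: (big_ind C) => // i _; exact: CZ.
Qed.

Lemma convex_cone_convex C : convex_cone C -> @convex_set R V C.
Proof.
move=> [C0 CD CZ]; apply/convex_setP => x y t t0 t1 Cx Cy.
by apply: CD; apply: CZ; rewrite // subr_ge0.
Qed.

Lemma convex_cone_closure C : convex_cone C -> convex_cone (vclosure C).
Proof.
move=> [C0 CD CZ]; split; first exact: sub_vclosure.
  move=> x y /vclosureP Cx /vclosureP Cy; apply/vclosureP => e e0.
  have e2 : 0 < e / 2 by rewrite divr_gt0.
  have [x' Cx' xx'] := Cx _ e2; have [y' Cy' yy'] := Cy _ e2.
  exists (x' + y'); first exact: CD.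
  by rewrite opprD addrACA (le_lt_trans (ler_cnormD _ _)) // [e]splitr ltrD.
move=> k x k0 /vclosureP Cx; apply/vclosureP => e e0.
have [|x' Cx' xx'] := Cx (e / (k + 1)); first by rewrite divr_gt0 // ltr_wpDl.
exists (k *: x'); first exact: CZ.
rewrite -scalerBr cnormZ ger0_norm //.
rewrite ltr_pdivlMr ?ltr_wpDl // mulrC mulrDl mul1r in xx'.
by rewrite (le_lt_trans _ xx') // lerDl cnorm_ge0.
Qed.

Lemma cone_hull_cone (X : set V) : convex_cone (cone_hull X).
Proof.
split.
- by exists 0%N, (fun=> 0), (fun=> 0); split=> [[]//|]; rewrite big_ord0.
- move=> _ _ [n [c [u [cu ->]]]] [m [c' [u' [cu' ->]]]].
  exists (n + m)%N, (fun i => match fintype.split i with inl j => c j | inr j => c' j end),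
    (fun i => match fintype.split i with inl j => u j | inr j => u' j end); split.
    by move=> i; case: fintype.splitP.
  rewrite big_split_ord /=; congr (_ + _); apply: eq_bigr => i _.
    by rewrite (unsplitK (inl _ i)).
  by rewrite (unsplitK (inr _ i)).
- move=> k _ k0 [n [c [u [cu ->]]]]; exists n, (fun i => k * c i), u; split.
    by move=> i; have [? ?] := cu i; split=> //; exact: mulr_ge0.
  by rewrite scaler_sumr; apply: eq_bigr => i _; rewrite scalerA.
Qed.

Lemma cone_hull_sub (X : set V) : X `<=` cone_hull X.
Proof.
move=> x Xx; exists 1%N, (fun=> 1), (fun=> x); split=> //.
by rewrite big_ord1 scale1r.
Qed.

Lemma cone_hull_min (X C : set V) : convex_cone C -> X `<=` C ->
  cone_hull X `<=` C.
Proof.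
move=> cC XC _ [n [c [u [cu ->]]]]; apply: convex_cone_sum => // i.
  by case: (cu i).
by apply: XC; case: (cu i).
Qed.

Lemma convex_cone_preimage (f : 'End(V)) C : convex_cone C ->
  convex_cone [set x | C (f x)].
Proof.
move=> [C0 CD CZ]; split=> /= [|x y|k x k0].
- by rewrite linear0.
- by rewrite linearD; exact: CD.
- by rewrite linearZ; exact: CZ.
Qed.

Lemma convex_cone_halfspace (f : 'Hom(V, R^o)) : convex_cone [set x | 0 <= (f x : R)].
Proof.
split=> /= [|x y|k x k0].
- by rewrite linear0.
- by rewrite linearD; exact: addr_ge0.
- by rewrite linearZ; exact: mulr_ge0.
Qed.

(** The radial tangent cone of Q at z. *)
Definition feasible Q z : set V := [set d | exists2 e : R, 0 < e & Q (z + e *: d)].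

(** Convexity lets two feasible directions be shrunk to a common length and
    averaged. *)
Lemma feasible_cone Q z : @convex_set R V Q -> Q z -> convex_cone (feasible Q z).
Proof.
move=> /convex_setP cQ Qz.
have shrink d (e e' : R) : 0 < e -> e' <= e -> 0 <= e' -> Q (z + e *: d) -> Q (z + e' *: d).
  move=> e0 ee' e'0 Qe; have te : e' / e <= 1 by rewrite ler_pdivrMr ?mul1r.
  have := cQ _ _ _ (divr_ge0 e'0 (ltW e0)) te Qe Qz; congr (Q _).
  rewrite scalerDr addrAC -scalerDl subrKC scale1r scalerA.
  by congr (_ + _ *: _); rewrite divfK ?gt_eqF.
split; first by exists 1; rewrite // scaler0 addr0.
  move=> d d' [e e0 Qe] [e' e'0 Qe'].
  have m0 : 0 < Num.min e e' by rewrite lt_min e0.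
  have mE : Num.min e e' <= e by rewrite ge_min lexx.
  have mE' : Num.min e e' <= e' by rewrite ge_min lexx orbT.
  exists (Num.min e e' / 2); first by rewrite divr_gt0.
  have h0 : 0 <= 2^-1 :> R by lra.
  have h1 : 2^-1 <= 1 :> R by lra.
  have := cQ _ _ _ h0 h1 (shrink _ _ _ e0 mE (ltW m0) Qe)
    (shrink _ _ _ e'0 mE' (ltW m0) Qe').
  congr (Q _); rewrite !scalerDr addrACA -scalerDl subrKC scale1r.
  by rewrite !scalerA -[1 - 2^-1](_ : 2^-1 = _) 1?mulrC //; lra.
move=> k d; rewrite le_eqVlt => /orP[/eqP <- _|k0 [e e0 Qe]].
  by exists 1; rewrite // scale0r scaler0 addr0.
exists (e / k); first by rewrite divr_gt0.
by rewrite scalerA divfK ?gt_eqF.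
Qed.

(** The parameters of the points of Q form a closed set, and at its supremum
    the hypothesis allows a further step unless x has been reached. *)
Lemma closed_segment_continuation Q x y : vclosed Q -> @convex_set R V Q -> Q y ->
  (forall t : R, 0 <= t -> t < 1 -> Q (y + t *: (x - y)) ->
    feasible Q (y + t *: (x - y)) (x - y)) -> Q x.
Proof.
move=> cQ /convex_setP vQ Qy step; apply: contrapT => Qx.
pose I := [set t : R | 0 <= t /\ Q (y + t *: (x - y))].
have I1 t : I t -> t < 1.
  move=> [t0 Qt]; rewrite ltNge; apply/negP => t1; apply: Qx.
  have t00 : 0 < t by lra.
  have ti0 : 0 <= t^-1 by rewrite invr_ge0.
  have ti1 : t^-1 <= 1 by rewrite invf_le1.
  have := vQ _ _ _ ti0 ti1 Qt Qy; congr (Q _).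
  rewrite scalerDr addrAC -scalerDl subrKC scale1r scalerA mulVf ?gt_eqF //.
  by rewrite scale1r subrKC.
have I0 : I 0 by split=> //; rewrite scale0r addr0.
have supI : has_sup I by split; [exists 0|exists 1 => t /I1/ltW].
have Is : I (sup I).
  split; first exact: sup_upper_bound.
  move/vclosedP: cQ; apply => e e0.
  have d0 : 0 < e / (cnorm (x - y) + 1) by rewrite divr_gt0 // ltr_wpDl ?cnorm_ge0.
  have [t It st] := sup_adherent d0 supI.
  exists (y + t *: (x - y)); first by case: It.
  rewrite addrAC opprD addrA subrr sub0r addrC -scalerBl cnormZ.
  have ts : t <= sup I by exact: sup_upper_bound.
  rewrite ler0_norm ?subr_le0 // opprB.
  rewrite ltrBlDr -ltrBlDl ltr_pdivlMr ?ltr_wpDl ?cnorm_ge0 // in st.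
  have := cnorm_ge0 (x - y); nra.
have [s0 Qs] := Is; have s1 := I1 _ Is.
have [e e0] := step _ s0 s1 Qs.
rewrite -addrA -scalerDl => Qe.
have : I (sup I + e) by split=> //; rewrite addr_ge0 // ltW.
by move=> /(sup_upper_bound supI); rewrite gerDl leNgt e0.
Qed.

End ConvexSets.

(** * Separation *)

Section Farkas.
Variable (R : realType).

(** Induction on the number of inequalities: if the last one fails at a
    solution of the others, the whole system can be projected along that
    solution. *)
Lemma farkas (X : vectType R) m (a : 'I_m -> 'Hom(X, R^o)) (b : 'Hom(X, R^o)) :
  (exists2 c : 'I_m -> R, forall i, 0 <= c i & b = \sum_i c i *: a i) \/
  (exists2 x, forall i, 0 <= (a i x : R) & (b x : R) < 0).
Proof.
elim: m a b => [|m ih] a b.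
  have [->|] := eqVneq b 0; first by left; exists (fun=> 0); rewrite ?big_ord0.
  move=> /lfunPn[x]; rewrite zero_lfunE => bx; right.
  have [bx0|bx0|bx0] := ltgtP (b x : R) 0.
  - by exists x => // -[].
  - by exists (- x) => [[]//|]; rewrite linearN /= oppr_lt0.
  - by move/eqP: bx; case.
pose w : 'I_m -> 'I_m.+1 := lift ord_max.
have wE (i : 'I_m) : widen_ord (leqnSn m) i = w i.
  by apply/val_inj; rewrite /= /bump leqNgt ltn_ord.
have [[c c0 ->]|[x0 ax0 bx0]] := ih (a \o w) b.
  left; exists (fun i => oapp c 0 (unlift ord_max i)).
    by move=> i; case: unliftP => [j|] _ //=.
  rewrite big_ord_recr /= unlift_none scale0r addr0; apply: eq_bigr => i _.
  by rewrite wE /= liftK.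
have [am|am] := leP 0 (a ord_max x0 : R).
  right; exists x0 => // i; by have [j ->|->//] := unliftP ord_max i; exact: ax0.
pose k := - (a ord_max x0 : R)^-1.
have k0 : 0 < k by rewrite /k oppr_gt0 invr_lt0.
pose x1 := k *: x0.
have ax1 i : 0 <= (a (w i) x1 : R) by rewrite linearZ; apply: mulr_ge0 (ltW k0) (ax0 i).
have bx1 : (b x1 : R) < 0 by rewrite linearZ [X in X < _]/(_ * _) pmulr_rlt0.
have amx1 : (a ord_max x1 : R) = -1.
  have -> : (a ord_max x1 : R) = k * (a ord_max x0 : R) by rewrite linearZ.
  by rewrite /k mulNr mulVf ?lt_eqF.
clearbody x1.
(* Adding multiples of the last functional makes the others and b vanish
   at x1. *)
have [[c c0 bE]|[x ax bx]] := ih (fun i => a (w i) + (a (w i) x1 : R) *: a ord_max)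
  (b + (b x1 : R) *: a ord_max).
  left; exists (fun i => oapp c (\sum_j c j * (a (w j) x1 : R) - b x1) (unlift ord_max i)).
    move=> i; case: unliftP => //= _.
    rewrite subr_ge0 (le_trans (ltW bx1)) // sumr_ge0 // => j _.
    exact: mulr_ge0.
  rewrite big_ord_recr /= unlift_none /= scalerBl addrA; apply/eqP.
  rewrite -subr_eq opprK bE scaler_suml -big_split /=; apply/eqP/eq_bigr => i _.
  by rewrite wE liftK /= scalerDr scalerA.
right; exists (x + (a ord_max x : R) *: x1) => [i|]; last first.
  move: bx; rewrite functional_addE functional_scaleE functionalD functionalZ.
  by rewrite mulrC.
have [j ->|->] := unliftP ord_max i.
  have := ax j; rewrite functional_addE functional_scaleE functionalD functionalZ.
  by rewrite mulrC.
by rewrite functionalD functionalZ amx1 mulrN1 subrr.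
Qed.

Variable V : vectType R.

Definition evaluation_fun (x : V) (f : 'Hom(V, R^o)) : R^o := f x.

Lemma evaluation_fun_is_linear x : linear (evaluation_fun x).
Proof. by move=> k f g; rewrite /evaluation_fun add_lfunE scale_lfunE. Qed.

HB.instance Definition _ x := GRing.isLinear.Build R 'Hom(V, R^o) R^o *:%R
  (evaluation_fun x) (evaluation_fun_is_linear x).

Definition evaluation (x : V) : 'Hom('Hom(V, R^o), R^o) :=
  linfun (evaluation_fun x).

Lemma evaluationE x f : evaluation x f = f x. Proof. exact: lfunE. Qed.

(** Besides its use in duality, this reduces an identity between vectors to
    one between scalars. *)
Lemma separate_points (x y : V) :
  (forall f : 'Hom(V, R^o), (f x : R) = (f y : R)) -> x = y.
Proof.
move=> fxy; rewrite (cnorm_coord x) (cnorm_coord y); apply: eq_bigr => i _.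
have := fxy (linfun (coord (vbasis {:V}) i : V -> R^o)).
by rewrite !lfunE /= => ->.
Qed.

Lemma finite_cone_separation (X : set V) (l : seq V) (d : V) :
  (forall x, X x -> x \in l) -> ~ cone_hull X d ->
  exists2 f : 'Hom(V, R^o), forall x, X x -> 0 <= (f x : R) & (f d : R) < 0.
Proof.
move=> Xl Xd; pose l' := [seq x <- l | `[< X x >]].
have [[c c0 dE]|[f fl fd]] :=
  farkas (fun i : 'I_(size l') => evaluation l'`_i) (evaluation d).
  case: Xd; exists (size l'), c, (fun i => l'`_i); split=> [i|].
    split=> //; have : l'`_i \in l' by rewrite mem_nth.
    by rewrite mem_filter => /andP[/asboolP].
  apply: separate_points => f; move/lfunP/(_ f): dE; rewrite evaluationE => ->.
  rewrite sum_lfunE linear_sum; apply: eq_bigr => i _ /=.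
  by rewrite scale_lfunE evaluationE linearZ.
exists f => [x Xx|]; last by rewrite -evaluationE.
have xl : x \in l' by rewrite mem_filter Xl // andbT; apply/asboolP.
have xi : (index x l' < size l')%N by rewrite index_mem.
by have := fl (Ordinal xi); rewrite evaluationE /= nth_index.
Qed.

(** A point outside the cone is cut off by a closed half-space. *)
Lemma finite_cone_closed (X : set V) (l : seq V) :
  (forall x, X x -> x \in l) -> vclosed (cone_hull X).
Proof.
move=> Xl; apply/vclosedP => d cld; apply: contrapT => Xd.
have [f fX fd] := finite_cone_separation Xl Xd.
have: 0 <= (f d : R); last by rewrite leNgt fd.
have /vclosedP := @vclosed_le R V f 0; apply => e e0.
have [y Xy yd] := cld _ e0; exists y => //.
have := cone_hull_min (convex_cone_halfspace f); apply; last exact: Xy.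
by move=> x /fX.
Qed.

(** Extension theorem of M. Riesz. The order unit p makes the conditions on
    the value at each new vector two-sided, and - p being outside C starts the
    induction. *)
Lemma riesz_extension C p : convex_cone C -> ~ C (- p) ->
  (forall x, exists2 n : R, 0 <= n & C (n *: p + x)) ->
  exists2 f : 'Hom(V, R^o), (f p : R) = 1 & forall x, C x -> 0 <= (f x : R).
Proof.
move=> [C0 CD CZ] Cp unit.
suff ext (l : seq V) : exists2 f : 'Hom(V, R^o), (f p : R) = 1 &
    forall x, x \in <<p :: l>>%VS -> C x -> 0 <= (f x : R).
  have [f fp fC] := ext (vbasis {:V}).
  exists f => // x; apply: fC; apply: (subvP (sub_span (X := vbasis {:V}) _)).
    by move=> y yb; rewrite inE yb orbT.
  by rewrite (span_basis (vbasisP _)) memvf.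
elim: l => [|e l [f fp fC]].
  have p0 : p != 0 by apply: contra_notN Cp => /eqP ->; rewrite oppr0.
  have [g] := linear_of_free [:: p] [:: 1 : R^o].
  rewrite seq1_free => /(_ p0 erefl) [gp].
  exists (linfun g); first by rewrite lfunE.
  move=> x; rewrite span_seq1 => /vlineP[k ->] Ck.
  rewrite functionalZ lfunE /= gp mulr1 leNgt; apply/negP => k0; apply: Cp.
  have : C ((- k)^-1 *: (k *: p)) by apply: CZ; rewrite // invr_ge0 oppr_ge0 ltW.
  by rewrite scalerA invrN mulNr mulVf ?lt_eqF // scaleN1r.
pose U := <<p :: l>>%VS.
have pU : p \in U by rewrite memv_span // inE eqxx.
have spanE : <<p :: e :: l>>%VS = (<[e]> + U)%VS.
  by rewrite /U !span_cons !addvA (addvC <[p]>%VS).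
have [eU|eU] := boolP (e \in U).
  have eE : (<[e]> + U = U)%VS by apply/addv_idPr; rewrite -memvE.
  by exists f => // x; rewrite spanE eE; exact: fC.
pose e' := e - projv U e.
have e'0 : e' != 0.
  by apply: contraNneq eU => /subr0_eq ->; exact: memv_proj.
have [g0] := linear_of_free [:: e'] [:: 1 : R^o].
rewrite seq1_free => /(_ e'0 erefl) [g0e'].
pose g : 'Hom(V, R^o) := (linfun g0 \o (\1 - projv U))%VF.
have gU x : x \in U -> (g x : R) = 0.
  by move=> xU; rewrite comp_lfunE add_lfunE opp_lfunE id_lfunE projv_id // subrr linear0.
have ge : (g e : R) = 1.
  by rewrite comp_lfunE add_lfunE opp_lfunE id_lfunE -/e' lfunE.
clearbody g.
(* The admissible values at e lie between those forced by C from below, the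
   elements of A, and those forced from above; take their supremum. *)
pose A := [set t : R | exists2 u, u \in U & C (u + e) /\ t = - (f u : R)].
have [n n0 Cn] := unit e; have [m m0 Cm] := unit (- e).
have Aub u : u \in U -> C (u - e) -> ubound A (f u : R).
  move=> uU Cu _ [u' u'U [Cu' ->]]; rewrite -subr_ge0 opprK -functionalD.
  apply: fC; first exact: memvD.
  by have := CD _ _ Cu Cu'; rewrite addrACA addNr addr0.
have supA : has_sup A.
  split; first by exists (- (f (n *: p) : R)), (n *: p); rewrite ?memvZ.
  by exists (f (m *: p) : R); apply: Aub; rewrite ?memvZ.
exists (f + (sup A - (f e : R)) *: g).
  by rewrite functional_addE functional_scaleE gU // mulr0 addr0.
move=> x; rewrite spanE => /memv_addP[_ /vlineP[k ->] [u uU ->]].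
have -> : ((f + (sup A - (f e : R)) *: g) (k *: e + u) : R) = k * sup A + f u.
  rewrite functional_addE functional_scaleE !functionalD !functionalZ (gU _ uU) ge; ring.
have CZi j : 0 < j -> C (k *: e + u) -> C (j^-1 *: u + (k / j) *: e).
  move=> j0 Cx; have : C (j^-1 *: (k *: e + u)) by apply: CZ; rewrite // invr_ge0 ltW.
  by rewrite scalerDr addrC scalerA mulrC.
move=> Cx; have [k0|k0|k0] := ltgtP k 0.
- have := CZi (- k); rewrite oppr_gt0 => /(_ k0 Cx).
  rewrite invrN mulrN divff ?lt_eqF // scaleN1r => Cx'.
  have := sup_le_ub supA.1 (Aub _ (memvZ _ uU) Cx'); rewrite functionalZ.
  have kV : k * k^-1 = 1 by rewrite divff ?lt_eqF.
  move=> /(ler_wnM2l (ltW k0)); rewrite mulrA mulrN kV; lra.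
- have := CZi k k0 Cx; rewrite divff ?gt_eqF // scale1r => Cx'.
  have /(sup_upper_bound supA) : A (- (f (k^-1 *: u) : R)) by exists (k^-1 *: u); rewrite ?memvZ.
  rewrite functionalZ => /(ler_wpM2l (ltW k0)).
  by rewrite mulrN mulrA divff ?gt_eqF //; lra.
- by move: Cx; rewrite k0 scale0r mul0r !add0r; exact: fC.
Qed.

End Farkas.

(** * Roots and walls of the fundamental chamber *)

Section CoxeterGroup.
Variables (R : realType) (V : vectType R) (S : finType) (D : reflection_data V S).
Local Notation alpha := (sroot D).
Local Notation check := (scoroot D).
Local Notation r := (srefl D).
Local Notation W := (W D).
Local Notation K := (K D).
Implicit Types (w u : 'End(V)) (x y z v : V) (s t : S) (a b : 'Hom(V, R^o)) (c : V).

Lemma reflection_fix a c x : (a x : R) = 0 -> reflection a c x = x.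
Proof. by move=> ax; rewrite reflectionE ax scale0r subr0. Qed.

Lemma functional_reflection a c b x :
  (b (reflection a c x) : R) = (b x : R) - (a x : R) * (b c : R).
Proof. by rewrite reflectionE functionalB functionalZ. Qed.

Lemma reflectionK a c : (a c : R) = 2 -> involutive (reflection a c).
Proof.
move=> ac x; rewrite [in LHS]reflectionE functional_reflection reflectionE ac.
rewrite -addrA -opprD -scalerDl.
have E : (a x : R) + ((a x : R) - (a x : R) * 2) = 0 by ring.
by rewrite E scale0r subr0.
Qed.

Lemma srefl_involutive s : involutive (r s).
Proof. by apply: reflectionK; exact: sroot_scoroot. Qed.

Lemma srefl_comp_id s w : (r s \o (r s \o w) = w)%VF.
Proof. by apply/lfunP => x; rewrite !comp_lfunE srefl_involutive. Qed.

Lemma lker0_inj w : injective w -> lker w == 0%VS.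
Proof. by move=> wi; apply/lker0P. Qed.

Lemma W_inj w : W w -> injective w.
Proof.
elim=> [x y|s||f Wf fi]; first by rewrite !id_lfunE.
- exact: inv_inj (srefl_involutive s).
- by move=> f g _ fi _ gi x y; rewrite !comp_lfunE => /fi/gi.
- by apply: (can_inj (g := f)); apply: lker0_lfunVK; exact: lker0_inj.
Qed.

Lemma W_cancel w : W w -> cancel w (w^-1)%VF.
Proof. by move=> /W_inj wi; apply/lker0_lfunK/lker0_inj. Qed.

Lemma W_cancelV w : W w -> cancel (w^-1)%VF w.
Proof. by move=> /W_inj wi; apply/lker0_lfunVK/lker0_inj. Qed.

Lemma dual_actE w a x : dual_act w a x = a ((w^-1)%VF x).
Proof. by rewrite comp_lfunE. Qed.

Lemma dual_act_apply w a x : W w -> dual_act w a (w x) = a x.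
Proof. by move=> Ww; rewrite dual_actE W_cancel. Qed.

Lemma dual_actV w a x : W w -> dual_act (w^-1)%VF a x = a (w x).
Proof.
by move=> Ww; rewrite -{1}(W_cancel Ww x) dual_act_apply //; exact: W_inv.
Qed.

Lemma dual_act_srefl s a x : dual_act (r s) a x = a (r s x).
Proof. by rewrite -{1}(srefl_involutive s x) dual_act_apply //; exact: W_refl. Qed.

Lemma coroot_simple s : is_coroot D (alpha s) (check s).
Proof.
exists \1%VF; first exact: W_one.
exists s; rewrite id_lfunE; split=> //; apply/lfunP => x.
by have := dual_act_apply (alpha s) x (W_one D); rewrite id_lfunE => ->.
Qed.

Lemma coroot_act u a c : W u -> is_coroot D a c -> is_coroot D (dual_act u a) (u c).
Proof.
move=> Wu [w Ww [s [-> ->]]]; exists (u \o w)%VF; first exact: W_comp.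
exists s; rewrite comp_lfunE; split=> //; apply/lfunP => x.
rewrite -(W_cancelV Wu x) dual_act_apply // -(W_cancelV Ww (_ x)) dual_act_apply //.
by rewrite -[u (w _)]comp_lfunE dual_act_apply //; exact: W_comp.
Qed.

Lemma coroot_is_root a c : is_coroot D a c -> is_root D a.
Proof. by move=> [w Ww [s [-> _]]]; exists w => //; exists s. Qed.

Lemma root_coroot a c : is_coroot D a c -> (a c : R) = 2.
Proof. by move=> [w Ww [s [-> ->]]]; rewrite dual_act_apply // sroot_scoroot. Qed.

Lemma reflection_conj u a c x : W u ->
  u (reflection a c x) = reflection (dual_act u a) (u c) (u x).
Proof. by move=> Wu; rewrite !reflectionE linearB linearZ /= dual_act_apply. Qed.

Lemma reflection_W a c : is_coroot D a c -> W (reflection a c).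
Proof.
move=> [w Ww [s [-> ->]]].
have -> : reflection (dual_act w (alpha s)) (w (check s)) = (w \o (r s \o w^-1))%VF.
  by apply/lfunP => x; rewrite !comp_lfunE reflection_conj // W_cancelV.
by do !apply: W_comp => //; [exact: W_refl|exact: W_inv].
Qed.

Hypothesis hD : linear_coxeter_system D.

(** Strict inequalities describe the interior of the chamber, see
    [interior_chamberE]. *)
Definition open_chamber : set V := [set x | forall s, 0 < (alpha s x : R)].
Local Notation K0 := open_chamber.

Lemma interior_chamberE : vinterior K = K0.
Proof.
apply/seteqP; split=> x Kx.
  move=> s; have [e e0 /(_ s)] := interior_feasible (- check s) Kx.
  by rewrite functionalD functionalZ functionalN sroot_scoroot; have := e0; lra.
have [|e e0 ex] := @small_vectors R V S (enum S) alpha (fun s => alpha s x).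
  by move=> s _; exact: Kx.
apply/vinteriorP; exists e => // y yx s.
have := ex _ yx s (mem_enum _ _); rewrite functionalB ltr_norml.
by move=> /andP[+ _]; rewrite ltrBrDr addNr => /ltW.
Qed.

Lemma open_chamber_sub x : K0 x -> K x.
Proof. by move=> Kx s; apply/ltW. Qed.

Lemma open_chamber_nonempty : exists p, K0 p.
Proof. by case: hD => -[p]; rewrite interior_chamberE => Kp _ _; exists p. Qed.

(** The third axiom of a linear Coxeter system in pointwise form; every
    relation in W below is obtained from it. *)
Lemma chamber_action_free w x : W w -> K0 x -> K0 (w x) -> w = \1%VF.
Proof.
case: hD => _ _ sep Ww Kx Kwx; apply: contrapT => w1.
suff : ([set w x | x in vinterior K] `&` vinterior K) (w x) by rewrite sep.
by rewrite interior_chamberE; split=> //; exists x.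
Qed.

(** Otherwise the reflection in the root would fix an interior point of K. *)
Lemma root_neq0 a c x : is_coroot D a c -> K0 x -> (a x : R) != 0.
Proof.
move=> rac Kx; apply/eqP => ax.
have r1 : reflection a c = \1%VF.
  by apply: (chamber_action_free (reflection_W rac) Kx); rewrite reflection_fix.
have := functional_reflection a c a c; rewrite r1 id_lfunE (root_coroot rac).
by lra.
Qed.

Lemma chamber_segment p x (t : R) : K0 p -> K x -> 0 <= t -> t < 1 ->
  K0 (t *: x + (1 - t) *: p).
Proof.
move=> Kp Kx t0 t1 s; rewrite functionalD !functionalZ.
by rewrite ltr_wpDl ?mulr_ge0 // ?mulr_gt0 ?subr_gt0 //; exact: Kx.
Qed.

(** By the intermediate value theorem on the segment from p to x, whose points
    other than x are interior. *)
Lemma root_sign a c p x : is_coroot D a c -> K0 p -> K x -> 0 <= (a p : R) * (a x : R).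
Proof.
move=> rac Kp Kx; rewrite leNgt; apply/negP => neg.
have ap := root_neq0 rac Kp.
have ax : (a p : R) - a x != 0.
  by apply: contraTneq neg => /subr0_eq <-; rewrite -leNgt -expr2 sqr_ge0.
suff [t [t0 t1 tE]] : exists t : R, [/\ 0 <= t, t < 1 & t * a x + (1 - t) * a p = 0].
  have := root_neq0 rac (chamber_segment Kp Kx t0 t1).
  by rewrite functionalD !functionalZ tE eqxx.
(* The affine function a vanishes at this parameter of the segment [p, x]. *)
exists ((a p : R) / ((a p : R) - a x)).
case: (ltgtP (a p : R) 0) => [ap0|ap0|E]; last by rewrite E eqxx in ap.
- have ax0 : 0 < (a x : R) by nra.
  split; last by field.
  - by rewrite -mulrNN -invrN divr_ge0 //; lra.
  - by rewrite -mulrNN -invrN ltr_pdivrMr; lra.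
- have ax0 : (a x : R) < 0 by nra.
  split; last by field.
  - by rewrite divr_ge0 //; lra.
  - by rewrite ltr_pdivrMr; lra.
Qed.

Variable p : V.
Hypothesis Kp : K0 p.

Lemma positive_root_ge0 a c x : is_coroot D a c -> 0 < (a p : R) -> K x -> 0 <= (a x : R).
Proof. by move=> rac ap /(root_sign rac Kp); rewrite pmulr_rge0. Qed.

Lemma negative_root_le0 a c x : is_coroot D a c -> (a p : R) < 0 -> K x -> (a x : R) <= 0.
Proof. by move=> rac ap /(root_sign rac Kp); rewrite nmulr_rge0. Qed.

Lemma negative_on_chamber a c w x : is_coroot D a c -> W w -> (a (w p) : R) < 0 ->
  K x -> (a (w x) : R) <= 0.
Proof.
move=> rac Ww; rewrite -!(dual_actV _ _ Ww) => awp Kx.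
exact: negative_root_le0 (coroot_act (W_inv Ww) rac) awp Kx.
Qed.

Lemma positive_on_chamber a c w x : is_coroot D a c -> W w -> 0 < (a (w p) : R) ->
  K x -> 0 <= (a (w x) : R).
Proof.
move=> rac Ww; rewrite -!(dual_actV _ _ Ww) => awp Kx.
exact: positive_root_ge0 (coroot_act (W_inv Ww) rac) awp Kx.
Qed.

Lemma root_chamber_neq0 a c w : is_coroot D a c -> W w -> (a (w p) : R) != 0.
Proof.
move=> rac Ww; rewrite -!(dual_actV _ _ Ww).
exact: root_neq0 (coroot_act (W_inv Ww) rac) Kp.
Qed.

(** The second axiom, through the Farkas lemma, provides a point where only
    the inequality of s fails. *)
Lemma facet_point s : exists x,
  (alpha s x : R) = 0 /\ forall t, t != s -> 0 < (alpha t x : R).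
Proof.
case: hD => _ indep _.
pose l := [seq t <- enum S | t != s].
have [[c c0 sE]|[y ay sy]] := farkas (fun i => alpha (tnth (in_tuple l) i)) (alpha s).
  case: (indep s); exists (size l), c, (fun i => alpha (tnth (in_tuple l) i)); split=> // i.
  split=> //; exists (tnth (in_tuple l) i) => //= /eqP ts.
  by have := mem_tnth i (in_tuple l); rewrite /= mem_filter ts.
(* From p, go along y until alpha s vanishes. *)
have k0 : 0 < (alpha s p : R) / - (alpha s y : R).
  by rewrite divr_gt0 ?oppr_gt0 //; exact: Kp.
exists (p + ((alpha s p : R) / - (alpha s y : R)) *: y); split=> [|t ts].
  rewrite functionalD functionalZ invrN mulrN mulNr divfK ?subrr //.
  by rewrite lt_eqF.
rewrite functionalD functionalZ; apply: ltr_pwDl; first exact: Kp.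
apply: mulr_ge0 (ltW k0) _.
have tl : t \in in_tuple l by rewrite mem_filter ts mem_enum.
by have /tnthP[i ->] := tl; exact: ay.
Qed.

(** The walls adjacent to K are those of the simple roots. The root a need not
    be a simple root itself: W may send a simple root to a proper multiple of
    another one, which is why only proportionality holds. *)
Lemma wall_root a c s : is_coroot D a c -> 0 < (a p : R) -> (a (r s p) : R) < 0 ->
  (exists2 k : R, 0 < k & a = k *: alpha s) /\ reflection a c = r s.
Proof.
move=> rac ap arp; have [x [sx tx]] := facet_point s.
have Kx : K x by move=> t; have [->|/tx/ltW//] := eqVneq t s; rewrite sx.
have rx : r s x = x by exact: reflection_fix.
have ax : (a x : R) = 0.
  apply/eqP; rewrite eq_le (positive_root_ge0 rac ap Kx) andbT -rx.
  exact: negative_on_chamber rac (W_refl _ _) arp Kx.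
(* Near x the wall of s is a piece of the boundary of K, on which a keeps its
   sign in all directions along the wall. *)
have a_ker y : (alpha s y : R) = 0 -> (a y : R) = 0.
  move=> sy.
  have half z : (alpha s z : R) = 0 -> 0 <= (a z : R).
    move=> sz.
    have [|e e0 ez] := @small_perturbation R S [seq t <- enum S | t != s]
        (fun t => alpha t x) (fun t => alpha t z).
      by move=> t; rewrite mem_filter => /andP[/tx].
    have Kz : K (x + e *: z).
      move=> t; rewrite functionalD functionalZ.
      have [->|ts] := eqVneq t s; first by rewrite sx sz mulr0 addr0.
      by rewrite ltW // ez // ?ltW // mem_filter ts mem_enum.
    have := positive_root_ge0 rac ap Kz.
    by rewrite functionalD functionalZ ax add0r pmulr_rge0.
  apply/eqP; rewrite eq_le half // andbT -oppr_ge0 -functionalN half //.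
  by rewrite functionalN sy oppr0.
have aE y : (a y : R) = (a (check s) : R) / 2 * (alpha s y : R).
  have := a_ker (y - ((alpha s y : R) / 2) *: check s).
  rewrite !functionalB !functionalZ sroot_scoroot.
  by rewrite divfK // subrr => /(_ erefl); lra.
set k := (a (check s) : R) / 2 in aE.
have k0 : 0 < k by move: ap; rewrite aE pmulr_lgt0 //; exact: Kp.
split; first by exists k => //; apply/lfunP => y; rewrite aE functional_scaleE.
(* Both reflections reverse alpha s, so their product keeps the side of the
   wall on which a point close to x lies. *)
pose u := (reflection a c \o r s)%VF.
have Wu : W u by apply: W_comp; [exact: reflection_W rac|exact: W_refl].
have ux : u x = x by rewrite comp_lfunE rx reflection_fix.
have su y : (alpha s (u y) : R) = alpha s y.
  have neg z : (alpha s (reflection a c z) : R) = - (alpha s z : R).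
    apply: (mulfI (lt0r_neq0 k0)); rewrite mulrN -!aE functional_reflection.
    by rewrite (root_coroot rac); lra.
  rewrite comp_lfunE neg functional_reflection sroot_scoroot; lra.
have [|e e0 ex] := @small_perturbation R S [seq t <- enum S | t != s]
    (fun t => alpha t x) (fun t => alpha t (u p)).
  by move=> t; rewrite mem_filter => /andP[/tx].
have Kz : K0 (x + e *: p).
  move=> t; rewrite functionalD functionalZ; apply: ltr_wpDl; first exact: Kx.
  exact: mulr_gt0 e0 (Kp t).
have Kuz : K0 (u (x + e *: p)).
  move=> t; have [->|ts] := eqVneq t s; first by rewrite su; exact: Kz.
  rewrite linearD linearZ /= ux functionalD functionalZ ex ?(ltW e0) //.
  by rewrite mem_filter ts mem_enum.
have u1 := chamber_action_free Wu Kz Kuz.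
apply/lfunP => y; rewrite -{1}(srefl_involutive s y).
by rewrite -[reflection a c _]comp_lfunE -/u u1 id_lfunE.
Qed.

(** * Words, exchange and inversions *)

(** Words are not required to be reduced, so n is an upper bound for the
    length of an element of words n, which is all that the inductions use. *)
Fixpoint words n : set 'End(V) := if n is n'.+1
  then [set w | exists s, exists2 w', words n' w' & w = (r s \o w')%VF]
  else [set \1%VF].

Lemma words_W n w : words n w -> W w.
Proof.
elim: n w => [|n ih] w /=; first by move=> ->; exact: W_one.
by move=> [s [w' /ih Ww' ->]]; apply: W_comp => //; exact: W_refl.
Qed.

Lemma words_comp n m w w' : words n w -> words m w' -> words (n + m) (w \o w')%VF.
Proof.
elim: n w => [|n ih] w /=; first by move=> ->; rewrite comp_lfun1l.
move=> [s [w1 w1n ->]] w'm; exists s, (w1 \o w')%VF; first exact: ih.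
by rewrite comp_lfunA.
Qed.

Lemma words_inv n w : words n w -> words n (w^-1)%VF.
Proof.
move=> wn; suff [w' w'n ww'] : exists2 w', words n w' & forall x, w (w' x) = x.
  have -> // : (w^-1)%VF = w'.
  by apply/lfunP => x; rewrite -{1}(ww' x) (W_cancel (words_W wn)).
elim: n w wn => [|n ih] w /=; first by move=> ->; exists \1%VF => // x; rewrite !id_lfunE.
move=> [s [w1 /ih[w' w'n ww'] ->]]; exists (w' \o r s)%VF => [|x].
  suff : words (n + 1) (w' \o r s)%VF by rewrite addn1.
  by apply: words_comp => //; exists s, \1%VF => //; rewrite comp_lfun1r.
by rewrite !comp_lfunE ww' srefl_involutive.
Qed.

Lemma W_words w : W w -> exists n, words n w.
Proof.
elim=> [|s|f g _ [n fn] _ [m gm]|f _ [n fn]].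
- by exists 0%N.
- by exists 1%N; exists s, \1%VF => //; rewrite comp_lfun1r.
- by exists (n + m)%N; exact: words_comp.
- by exists n; exact: words_inv.
Qed.

Lemma words_finite n : exists l : seq 'End(V), forall w, words n w -> w \in l.
Proof.
elim: n => [|n [l ih]]; first by exists [:: \1%VF] => w /= ->; rewrite inE.
exists [seq (r s \o w)%VF | s <- enum S, w <- l] => w [s [w' /ih wl ->]].
by apply/allpairsP; exists (s, w'); rewrite mem_enum.
Qed.

(** On the way from K to w K the sign of a changes at some letter. By
    [wall_root], seen from the chamber reached there, the reflection in a is
    conjugate to that letter, and multiplying by it deletes the letter. *)
Lemma exchange n w a c : words n w -> is_coroot D a c -> 0 < (a p : R) ->
  (a (w p) : R) < 0 ->
  exists2 m, n = m.+1 & words m (reflection a c \o w)%VF.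
Proof.
elim: n w a c => [|n ih] w a c /=.
  by move=> -> _ ap; rewrite id_lfunE ltNge ltW.
move=> [s [w' w'n ->]] rac ap; rewrite comp_lfunE => awp; exists n => //.
have [ars|] := ltP (a (r s p) : R) 0.
  by have [_ ->] := wall_root rac ap ars; rewrite srefl_comp_id.
rewrite le_eqVlt eq_sym (negPf (root_chamber_neq0 rac (W_refl D s))) /= => ars.
have [||m -> wm] := ih _ _ _ w'n (coroot_act (W_refl D s) rac).
- by rewrite dual_act_srefl.
- by rewrite dual_act_srefl.
exists s, (reflection (dual_act (r s) a) (r s c) \o w')%VF => //.
apply/lfunP => x; rewrite !comp_lfunE [LHS]reflectionE [X in _ = r s X]reflectionE.
by rewrite [RHS]linearB [X in _ = _ - X]linearZ /= srefl_involutive dual_act_srefl.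
Qed.

(** A root changing sign between K and w K changes it at a letter of the word,
    and is then a multiple of the translate of that simple root. *)
Lemma inversions_finite n w : words n w -> exists l : seq 'Hom(V, R^o),
  forall a c, is_coroot D a c -> 0 < (a p : R) -> (a (w p) : R) < 0 ->
  exists2 b, b \in l & exists2 k : R, 0 < k & a = k *: b.
Proof.
elim: n w => [|n ih] w /=.
  by move=> ->; exists [::] => a c _ ap; rewrite id_lfunE ltNge ltW.
move=> [s [w' /ih[l linv] ->]].
exists (alpha s :: [seq dual_act (r s) b | b <- l]) => a c rac ap.
rewrite comp_lfunE => awp.
have [ars|] := ltP (a (r s p) : R) 0.
  have [[k k0 aE] _] := wall_root rac ap ars.
  by exists (alpha s); [rewrite inE eqxx|exists k].
rewrite le_eqVlt eq_sym (negPf (root_chamber_neq0 rac (W_refl D s))) /= => ars.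
have [||b bl [k k0 aE]] := linv _ _ (coroot_act (W_refl D s) rac).
- by rewrite dual_act_srefl.
- by rewrite dual_act_srefl.
exists (dual_act (r s) b); first by rewrite inE map_f ?orbT.
exists k => //; apply/lfunP => x; rewrite functional_scaleE dual_act_srefl.
by rewrite -functional_scaleE -aE dual_act_srefl srefl_involutive.
Qed.

(** If no simple root were negative at w p, the point w p would lie in the
    interior of K. *)
Lemma descent w : W w -> w <> \1%VF -> exists s, (alpha s (w p) : R) < 0.
Proof.
move=> Ww w1; apply: contrapT => nos; apply: w1.
apply: (chamber_action_free Ww Kp) => s; rewrite lt_def.
rewrite (root_chamber_neq0 (coroot_simple s) Ww) /= leNgt.
by apply/negP => neg; apply: nos; exists s.
Qed.

Lemma descent_exchange n w : words n w -> w <> \1%VF -> exists s m,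
  [/\ (alpha s (w p) : R) < 0, n = m.+1 & words m (r s \o w)%VF].
Proof.
move=> wn w1; have [s sw] := descent (words_W wn) w1.
have [m nm wm] := exchange wn (coroot_simple s) (Kp s) sw.
by exists s, m.
Qed.

(** Shorten w by a letter s whose root is negative on w K: passing from w v to
    r s (w v) subtracts a nonnegative multiple of the simple coroot. The cone
    C is arbitrary since the lemma serves for the coroot cone of v, for its
    description by stabilizers, and, at an interior point of K, for the cone
    of simple coroots. *)
Lemma orbit_sub_cone (C : set V) v w : convex_cone C -> K v -> W w ->
  (forall s, 0 < (alpha s v : R) -> C (check s)) ->
  (forall s, (alpha s v : R) = 0 -> forall x, C x -> C (r s x)) ->
  C (v - w v).
Proof.
move=> [C0 CD CZ] Kv /W_words[n]; elim: n w => [|n ih] w wn Cpos Cfix.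
  by move: wn => /= ->; rewrite id_lfunE subrr.
have [->|/eqP w1] := eqVneq w \1%VF; first by rewrite id_lfunE subrr.
have [s [m [sw [nm] wm]]] := descent_exchange wn w1.
rewrite -{}nm in wm.
have := ih _ wm Cpos Cfix; rewrite comp_lfunE => Cv.
have swv := negative_on_chamber (coroot_simple s) (words_W wn) sw Kv.
(* If s fixes v, conjugate by it; otherwise add the step along its coroot. *)
have := Kv s; rewrite le_eqVlt => /orP[/eqP/esym sv|/Cpos Cs].
  have := Cfix s sv _ Cv; rewrite linearB /= srefl_involutive.
  by rewrite [X in X - _]reflection_fix.
have -> : v - w v = (v - r s (w v)) + (- (alpha s (w v) : R)) *: check s.
  by rewrite [r s _]reflectionE opprB scaleNr addrA addrAC addrK.
by apply: CD => //; apply: CZ; rewrite // oppr_ge0.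
Qed.

End CoxeterGroup.

(** * Hulls of orbits and coroot cones *)

Section OrbitHull.
Variables (R : realType) (V : vectType R) (S : finType) (D : reflection_data V S).
Local Notation alpha := (sroot D).
Local Notation check := (scoroot D).
Local Notation r := (srefl D).
Local Notation W := (W D).
Local Notation K := (K D).
Local Notation K0 := (open_chamber D).
Local Notation co := (orbit_hull D).
Local Notation C_ := (coroot_cone D).
Implicit Types (w u : 'End(V)) (x y z v k : V) (s t : S) (a b : 'Hom(V, R^o)) (c : V).

Lemma orbit_in_hull v w : W w -> co v (w v).
Proof. by move=> Ww; apply: hull_sub; exists w. Qed.

Lemma self_in_hull v : co v v.
Proof. by have := orbit_in_hull (v := v) (W_one D); rewrite id_lfunE. Qed.

Lemma orbit_hull_act v u x : W u -> co v x -> co v (u x).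
Proof.
move=> Wu.
suff : co v `<=` [set x | co v (0 + u x)] by move=> sub /sub /=; rewrite add0r.
apply: hull_min.
- by apply: (@vclosed_preimage R V V u 0 (co v)); exact: hull_closed.
- by apply: (@convex_preimage R V u 0 (co v)); exact: hull_convex.
- move=> _ [w Ww <-] /=; rewrite add0r -comp_lfunE.
  by apply: orbit_in_hull; exact: W_comp.
Qed.

Lemma orbit_hull_orbit v u : W u -> co (u v) = co v.
Proof.
move=> Wu; congr (closed_convex_hull _); apply/seteqP; split=> _ [w Ww <-].
  by exists (w \o u)%VF; [exact: W_comp|rewrite comp_lfunE].
exists (w \o u^-1)%VF; first by apply: W_comp => //; exact: W_inv.
by rewrite comp_lfunE (W_cancel Wu).
Qed.

Lemma coroot_cone_mem v a c : is_coroot D a c -> 0 < (a v : R) -> C_ v c.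
Proof.
move=> rac av; apply: cone_hull_sub; exists a; split=> //.
exact: coroot_is_root rac.
Qed.

Lemma coroot_cone_act v u c : W u -> C_ v c -> C_ (u v) (u c).
Proof.
move=> Wu; move: c; apply: cone_hull_min.
  exact: convex_cone_preimage (cone_hull_cone _).
move=> c [a [_ rac av]] /=; apply: coroot_cone_mem (coroot_act Wu rac) _.
by rewrite (dual_act_apply _ _ Wu).
Qed.

Lemma closed_coroot_cone_act v u c : W u ->
  vclosure (C_ v) c -> vclosure (C_ (u v)) (u c).
Proof. by move=> Wu; apply: vclosure_image => y; exact: coroot_cone_act. Qed.

(** The translate v - C is closed and convex, and contains the orbit. *)
Lemma hull_sub_translate v (C : set V) x : convex_cone C -> vclosed C ->
  (forall w, W w -> C (v - w v)) -> co v x -> C (v - x).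
Proof.
move=> cC clC orbC.
suff : co v `<=` [set x | C (v + (- \1)%VF x)].
  by move=> sub /sub /=; rewrite opp_lfunE id_lfunE.
apply: hull_min.
- exact: (@vclosed_preimage R V V (- \1)%VF v C).
- by apply: (@convex_preimage R V (- \1)%VF v C); exact: convex_cone_convex.
- by move=> _ [w Ww <-] /=; rewrite opp_lfunE id_lfunE; exact: orbC.
Qed.

Hypothesis hD : linear_coxeter_system D.

Lemma orbit_coroot_cone v w : tits_cone D v -> W w -> C_ v (v - w v).
Proof.
have [p Kp] := open_chamber_nonempty hD.
move=> [u Wu [k Kk <-]] Ww.
have Wv := W_inv Wu.
have := coroot_cone_act (v := k) Wu.
rewrite -[u k - _](_ : u (k - (u^-1 \o (w \o u))%VF k) = _); last first.
  by rewrite linearB /= !comp_lfunE !(W_cancelV Wu).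
apply; apply: (orbit_sub_cone hD Kp) => //.
- exact: cone_hull_cone.
- by do 2!apply: W_comp => //.
- by move=> s; exact/coroot_cone_mem/coroot_simple.
- move=> s sk x Cx.
  by have := coroot_cone_act (W_refl D s) Cx; rewrite [r s k]reflection_fix.
Qed.

Section DominantHull.
Variables (p k x : V).
Hypotheses (Kp : K0 p) (Kk : K k) (Kx : K x).

(** A point y of the hull, interior to it relative to the affine space k +
    span C_k, and close enough to k to lie strictly on the positive side of
    every root positive at k. There may be infinitely many such roots, but y
    is a combination of k and of finitely many reflected points r_i k, and up
    to positive factors all but finitely many roots positive at k are
    nonnegative at all the r_i k. *)
Lemma hull_regular_point : exists l : seq V,
  (forall c, C_ k c -> c \in << l >>%VS) /\
  exists y, [/\ co k y,
    forall a c, is_coroot D a c -> 0 < (a k : R) -> 0 < (a y : R)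
  & exists2 e : R, 0 < e & forall d, d \in << l >>%VS -> cnorm d < e -> co k (y + d)].
Proof.
pose X := [set c | exists2 a, is_coroot D a c & 0 < (a k : R)].
have [|l [freel _ lX spanl]] := @free_subset_span R V X [::] (nil_free _); first by [].
exists l; split.
  move=> c [n [cf [u [cu ->]]]]; apply: memv_suml => i _; apply: memvZ.
  by apply: spanl; have [_ [a [_ rac ak]]] := cu i; exists a.
have coroots (i : 'I_(size l)) : exists2 a, is_coroot D a l`_i & 0 < (a k : R).
  by apply: lX; rewrite mem_nth.
pose a i := sval (cid2 (coroots i)).
have rac i : is_coroot D (a i) l`_i by rewrite /a; case: cid2.
have ak i : 0 < (a i k : R) by rewrite /a; case: cid2.
pose ref i := reflection (a i) l`_i.
have Wr i : W (ref i) by exact: reflection_W (rac i).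
have refk i : ref i k - k = - ((a i k : R) *: l`_i).
  by rewrite /ref reflectionE addrAC subrr add0r.
(* All roots whose walls separate K from one of the chambers ref i K. *)
have [L invL] : exists L : seq 'Hom(V, R^o), forall i b c, is_coroot D b c ->
    0 < (b p : R) -> (b (ref i p) : R) < 0 ->
    exists2 b', b' \in L & exists2 m : R, 0 < m & b = m *: b'.
  have inv i : exists L : seq 'Hom(V, R^o), forall b c, is_coroot D b c ->
      0 < (b p : R) -> (b (ref i p) : R) < 0 ->
      exists2 b', b' \in L & exists2 m : R, 0 < m & b = m *: b'.
    by have [n wn] := W_words (Wr i); exact: (inversions_finite hD Kp wn).
  have [Lf LfP] := choice inv.
  exists (flatten [seq Lf i | i <- enum 'I_(size l)]) => i b c rbc bp br.
  have [b' b'L bE] := LfP i b c rbc bp br.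
  exists b' => //; apply/flattenP; exists (Lf i) => //.
  by apply/mapP; exists i; rewrite ?mem_enum.
have [|e1 e10 e1P] := @small_perturbation R _ [seq b : 'Hom(V, R^o) <- L | 0 < (b k : R)]
    (fun b : 'Hom(V, R^o) => b k : R) (fun b : 'Hom(V, R^o) => - \sum_i (a i k : R) * (b l`_i : R)).
  by move=> b; rewrite mem_filter => /andP[].
pose m := size l.
pose e := Num.min e1 ((2 * m%:R + 1)^-1).
have m0 : 0 < 2 * m%:R + 1 :> R by rewrite ltr_wpDl // mulr_ge0.
have e0 : 0 < e by rewrite lt_min e10 invr_gt0.
have em : m%:R * (2 * e) <= 1.
  have : e <= (2 * m%:R + 1)^-1 by rewrite ge_min lexx orbT.
  rewrite -[X in _ <= X]mul1r ler_pdivlMr // => em.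
  by have := e0; lra.
(* Weights up to twice e leave room to move y within the span. *)
have in_hull (c : 'I_(size l) -> R) : (forall i, 0 <= c i) -> (forall i, c i <= 2 * e) ->
    co k (k + \sum_i c i *: (ref i k - k)).
  move=> c0 ce; apply: convex_combination => //.
  - exact: hull_convex.
  - exact: self_in_hull.
  - apply: le_trans em; rewrite -/m -[m in X in _ <= X]card_ord -sum1_card natr_sum.
    by rewrite mulr_suml; apply: ler_sum => i _; rewrite mul1r.
  - by move=> i; rewrite subrKC; exact: orbit_in_hull.
exists (k + \sum_i e *: (ref i k - k)); split.
- by apply: in_hull => i; have := e0; lra.
- move=> b c rbc bk.
  have bp : 0 < (b p : R).
    rewrite lt_def (root_neq0 hD rbc Kp) leNgt; apply: contraTN bk => bp.
    by rewrite -leNgt (negative_root_le0 hD Kp rbc bp Kk).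
  rewrite functionalD functional_sum.
  (* A root negative on some reflected chamber is a multiple of one of the
     finitely many in L; any other is nonnegative at all the points ref i k. *)
  have [[i bi]|nobi] := pselect (exists i, (b (ref i p) : R) < 0).
    have [b' b'L [m' m'0 bE]] := invL i b c rbc bp bi.
    have b'k : 0 < (b' k : R) by move: bk; rewrite bE functional_scaleE pmulr_rgt0.
    have := e1P e (ltW e0) _ b'; rewrite ge_min lexx mem_filter b'k => /(_ isT b'L).
    rewrite mulrN mulr_sumr -sumrN => b'y.
    rewrite -(pmulr_rgt0 _ m'0) mulrDr mulr_sumr in b'y.
    apply: (lt_le_trans b'y); rewrite bE functional_scaleE lerD2l.
    apply: ler_sum => j _; rewrite functionalZ refk functionalN functionalZ functional_scaleE.
    by lra.
  have bi i : 0 <= (b (ref i k) : R).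
    apply: (positive_on_chamber hD Kp rbc (Wr i)) => //.
    rewrite lt_def (root_chamber_neq0 hD Kp rbc (Wr i)) leNgt.
    by apply/negP => bi; apply: nobi; exists i.
  have : \sum_(i < size l) - (e * (b k : R)) <= \sum_(i < size l) (b (e *: (ref i k - k)) : R).
    apply: ler_sum => i _; rewrite functionalZ functionalB.
    by have := bi i; have := e0; nra.
  rewrite sumr_const card_ord -/m -mulr_natl.
  have := em; have := bk; have := e0; nra.
have [|eta eta0 etaP] := @small_vectors R V _ (enum 'I_(size l))
    (fun i => linfun (coord (in_tuple l) i : V -> R^o)) (fun i => e * (a i k : R)).
  by move=> i _; rewrite mulr_gt0.
exists eta => // d dl dn.
have -> : k + \sum_i e *: (ref i k - k) + d =
    k + \sum_i (e - coord (in_tuple l) i d / (a i k : R)) *: (ref i k - k).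
  rewrite -addrA {1}(coord_span (X := in_tuple l) dl) -big_split /=; congr (_ + _).
  apply: eq_bigr => i _; rewrite scalerBl refk; congr (_ + _).
  by rewrite scalerN opprK scalerA divfK ?gt_eqF.
apply: in_hull => i; have := etaP d dn i (mem_enum _ _);
  rewrite lfunE /= -ltr_pdivrMr // -[X in _ / X]gtr0_norm // -normf_div ltr_norml => /andP[]; lra.
Qed.

(** Go from y to x. At a point z of the hull before x every root a positive at
    k is positive, so r_a z shows that the hull extends from z in the
    direction of minus the coroot. Its feasible directions at z form a convex
    cone, which thus contains - C_k and k - z. Since x - k is only a limit of
    elements of - C_k, an error term remains, and it is absorbed by the
    neighbourhood of y in the hull. So x - z is feasible. *)
Lemma dominated_in_hull : vclosure (C_ k) (k - x) -> co k x.
Proof.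
move=> kx.
have [l [Cl [y [Qy ypos [eta eta0 Qd]]]]] := hull_regular_point.
have cQ := @hull_closed R V [set w k | w in W].
have vQ := @hull_convex R V [set w k | w in W].
rewrite -/(co k) in cQ vQ.
apply: (closed_segment_continuation cQ vQ Qy) => t t0 t1.
set z := y + t *: (x - y) => Qz.
have F := feasible_cone vQ Qz; set Fz := feasible _ z in F *.
have [F0 FD FZ] := F.
have zE : z = t *: x + (1 - t) *: y.
  by rewrite /z scalerBr scalerBl scale1r addrCA addrC.
clearbody z.
(* The segment from z to its image under the reflection in a runs along the
   coroot of a, and it has positive length because a is positive at y. *)
have FC c : C_ k c -> Fz (- c).
  move: c; apply: cone_hull_min => [|c [a [_ rac ak]] /=].
    have := convex_cone_preimage (- \1)%VF F; congr convex_cone.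
    by apply/funext => c /=; rewrite opp_lfunE id_lfunE.
  have ap : 0 < (a p : R).
    rewrite lt_def (root_neq0 hD rac Kp) leNgt; apply: contraTN ak => ap.
    by rewrite -leNgt (negative_root_le0 hD Kp rac ap Kk).
  have az : 0 < (a z : R).
    rewrite zE functionalD !functionalZ.
    have := positive_root_ge0 hD Kp rac ap Kx; have := ypos a c rac ak; nra.
  exists (a z : R) => //.
  have := orbit_hull_act (reflection_W rac) Qz.
  by rewrite reflectionE scalerN.
have Fk : Fz (k - z) by exists 1; rewrite // scale1r subrKC; exact: self_in_hull.
have kxl : k - x \in << l >>%VS.
  have /vclosedP := @vclosed_vspace R V << l >>%VS; apply => e e0.
  have /vclosureP/(_ e e0)[c Cc cn] := kx; exists c => //; exact: Cl.
pose lam := (1 - t) / 2.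
have lam0 : 0 < lam by rewrite divr_gt0 // subr_gt0.
(* Write k - x = c + e with c in the cone and e so small that the hull still
   contains y - lam^-1 e. *)
have /vclosureP/(_ (lam * eta))[|c Cc cn] := kx; first exact: mulr_gt0.
pose e := k - x - c.
have Fe : Fz (y - lam^-1 *: e - z).
  exists 1 => //; rewrite scale1r subrKC; apply: Qd.
    by rewrite rpredN rpredZ // rpredB //; exact: Cl.
  rewrite cnormN cnormZ ger0_norm ?invr_ge0 ?ltW // mulrC ltr_pdivrMr // [_ * lam]mulrC.
  by rewrite -cnormN /e opprB.
(* Since lam (y - z) = - (t / 2) (x - z), a positive multiple of x - z is
   left. *)
have := FD _ _ (FC _ Cc) (FD _ _ Fk (FZ _ _ (ltW lam0) Fe)).
have -> : - c + (k - z + lam *: (y - lam^-1 *: e - z)) = ((1 - t / 2) * (1 - t)) *: (x - y).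
  apply: separate_points => f.
  rewrite zE !(functionalD, functionalN, functionalZ) /lam.
  by field; lra.
move=> /(FZ ((1 - t / 2) * (1 - t))^-1); rewrite scalerA mulVf ?scale1r.
  by apply; rewrite invr_ge0 mulr_ge0 //; lra.
by rewrite mulf_neq0 //; lra.
Qed.

End DominantHull.

End OrbitHull.

(** * The Tits cone and stabilizers *)

Lemma maximum_on_seq (R : realType) (T : eqType) (l : seq T) (P : T -> Prop) (g : T -> R) :
  (exists2 x, x \in l & P x) ->
  exists x, P x /\ forall y, y \in l -> P y -> g y <= g x.
Proof.
elim: l => [|a l ih]; first by case=> x; rewrite in_nil.
have [/ih[x [Px xmax]] _|nol] := pselect (exists2 x, x \in l & P x).
  have [[Pa ax]|notb] := pselect (P a /\ g x <= g a).
    exists a; split=> // y; rewrite inE => /orP[/eqP ->//|yl Py].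
    exact: le_trans (xmax y yl Py) ax.
  exists x; split=> // y; rewrite inE => /orP[/eqP -> Pa|]; last exact: xmax.
  by rewrite leNgt; apply/negP => /ltW ax; apply: notb.
move=> [x]; rewrite inE => /orP[/eqP -> Pa|xl Px]; last by case: nol; exists x.
exists a; split=> // y; rewrite inE => /orP[/eqP ->//|yl Py].
by case: nol; exists y.
Qed.

Section TitsCone.
Variables (R : realType) (V : vectType R) (S : finType) (D : reflection_data V S).
Local Notation alpha := (sroot D).
Local Notation check := (scoroot D).
Local Notation r := (srefl D).
Local Notation W := (W D).
Local Notation K := (K D).
Local Notation K0 := (open_chamber D).
Local Notation co := (orbit_hull D).
Local Notation C_ := (coroot_cone D).
Local Notation T := (tits_cone D).
Local Notation C_S := (simple_coroot_cone D).
Implicit Types (w u : 'End(V)) (x y z v k : V) (s t : S) (a b : 'Hom(V, R^o)) (c : V).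

Lemma tits_act u x : W u -> T x -> T (u x).
Proof.
move=> Wu [w Ww [k Kk <-]]; exists (u \o w)%VF; first exact: W_comp.
by exists k => //; rewrite comp_lfunE.
Qed.

Lemma chamber_sub_tits : K `<=` T.
Proof. by move=> k Kk; exists \1%VF; [exact: W_one|exists k; rewrite ?id_lfunE]. Qed.

Lemma interior_tits_act u x : W u -> vinterior T x -> vinterior T (u x).
Proof.
move=> Wu /vinteriorP[e e0 eT]; apply/vinteriorP.
have [M M0 Mu] := linear_bounded (u^-1)%VF.
exists (e / M); first by rewrite divr_gt0.
move=> y yx; rewrite -(W_cancelV Wu y); apply: tits_act => //; apply: eT.
rewrite -(W_cancel Wu x) -linearB (le_lt_trans (Mu _)) //.
by rewrite mulrC -ltr_pdivlMr.
Qed.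

Hypothesis hD : linear_coxeter_system D.
Variable p : V.
Hypothesis Kp : K0 p.

(** Dominance algorithm: reflecting z in a simple root negative at z removes
    one letter of w, and keeps the hypothesis as the reflection permutes the
    positive roots not proportional to that simple root. *)
Lemma tits_of_negative_roots n w z : words D n w ->
  (forall a c, is_coroot D a c -> 0 < (a p : R) -> (a z : R) < 0 -> (a (w p) : R) < 0) ->
  T z.
Proof.
elim: n w z => [|n ih] w z wn neg.
  apply: chamber_sub_tits => s; rewrite leNgt; apply/negP => sz.
  have := neg _ _ (coroot_simple D s) (Kp s) sz; move: wn => /= ->.
  by rewrite id_lfunE ltNge ltW //; exact: Kp.
have [Kz|/existsNP[s /negP]] := pselect (K z); first exact: chamber_sub_tits.
rewrite -ltNge => sz.
have sw := neg _ _ (coroot_simple D s) (Kp s) sz.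
have [m [nm] wm] := exchange hD Kp wn (coroot_simple D s) (Kp s) sw.
rewrite -{}nm in wm.
rewrite -(srefl_involutive D s z); apply: tits_act; first exact: W_refl.
apply: (ih _ _ wm) => a c rac ap az.
rewrite -/(srefl D s) comp_lfunE -dual_act_srefl.
apply: (neg _ _ (coroot_act (W_refl D s) rac)); rewrite dual_act_srefl //.
rewrite lt_def (root_chamber_neq0 hD Kp rac (W_refl D s)) leNgt; apply/negP => ars.
have [[k k0 aE] _] := wall_root hD Kp rac ap ars.
move: az; rewrite aE functional_scaleE functional_reflection sroot_scoroot.
by have := k0; nra.
Qed.

(** For x in K and y in w K, a positive root negative at x + y is negative on
    w K. *)
Lemma tits_convex_cone : convex_cone T.
Proof.
have TD x y : K x -> T y -> T (x + y).
  move=> Kx [w Ww [k Kk <-]]; have [n wn] := W_words Ww.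
  apply: (tits_of_negative_roots wn) => a c rac ap.
  rewrite functionalD => axy.
  have ax := positive_root_ge0 hD Kp rac ap Kx.
  rewrite lt_def eq_sym (root_chamber_neq0 hD Kp rac Ww) /= leNgt; apply/negP => aw.
  have := positive_on_chamber hD Kp rac Ww aw Kk; lra.
split.
- by apply: chamber_sub_tits => s; rewrite linear0.
- move=> _ y [w Ww [k Kk <-]] Ty.
  rewrite -(W_cancelV Ww y) -linearD; apply: tits_act => //; apply: TD => //.
  exact/tits_act/Ty/W_inv.
- move=> m _ m0 [w Ww [k Kk <-]]; rewrite -linearZ; apply: tits_act => //.
  by apply: chamber_sub_tits => s; rewrite functionalZ mulr_ge0 //; exact: Kk.
Qed.

(** The descents of u in the stabilizer of v are walls through v, hence also
    descents of w, and can be removed from both at once. *)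
Lemma stabilizer_words n w u v : K v -> words D n w -> W u -> u v = v ->
  (forall a c, is_coroot D a c -> 0 < (a p : R) -> (a v : R) = 0 ->
    (a (u p) : R) < 0 -> (a (w p) : R) < 0) ->
  exists2 m, (m <= n)%N & words D m u.
Proof.
move=> Kv; elim: n w u => [|n ih] w u wn Wu uv neg;
  have [->|/eqP u1] := eqVneq u \1%VF; try by exists 0%N.
  have [s su] := descent hD Kp Wu u1.
  have sv : (alpha s v : R) = 0.
    apply/eqP; rewrite eq_le Kv andbT -[in X in X <= _]uv.
    exact: (negative_on_chamber hD Kp (coroot_simple D s) Wu su Kv).
  have := neg _ _ (coroot_simple D s) (Kp s) sv su; move: wn => /= ->.
  by rewrite id_lfunE ltNge ltW //; exact: Kp.
have [s su] := descent hD Kp Wu u1.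
have sv : (alpha s v : R) = 0.
  apply/eqP; rewrite eq_le Kv andbT -[in X in X <= _]uv.
  exact: (negative_on_chamber hD Kp (coroot_simple D s) Wu su Kv).
have sw := neg _ _ (coroot_simple D s) (Kp s) sv su.
have [m [nm] wm] := exchange hD Kp wn (coroot_simple D s) (Kp s) sw.
rewrite -{}nm in wm.
have rv : r s v = v by exact: reflection_fix.
have [||a c rac ap av au|m' m'n um'] := ih _ (r s \o u)%VF wm.
- by apply: W_comp => //; exact: W_refl.
- by rewrite comp_lfunE uv.
- rewrite -/(srefl D s) comp_lfunE -dual_act_srefl.
  apply: (neg _ _ (coroot_act (W_refl D s) rac)); rewrite dual_act_srefl ?rv //.
    rewrite lt_def (root_chamber_neq0 hD Kp rac (W_refl D s)) leNgt; apply/negP => ars.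
    have [[k k0 aE] _] := wall_root hD Kp rac ap ars.
    move: au; rewrite aE functional_scaleE comp_lfunE functional_reflection sroot_scoroot.
    by have := k0; nra.
  by move: au; rewrite comp_lfunE.
exists m'.+1 => //; exists s, (r s \o u)%VF => //.
by rewrite srefl_comp_id.
Qed.

(** An element q of T slightly beyond v as seen from p lies in some chamber w
    K, on the negative side of all walls through v; so lengths in the
    stabilizer are bounded by that of w. *)
Lemma stabilizer_finite v : K v -> vinterior T v ->
  exists l : seq 'End(V), forall u, W u -> u v = v -> u \in l.
Proof.
move=> Kv Tv; have [e e0 [w Ww [k Kk kE]]] := interior_feasible (v - p) Tv.
have [n wn] := W_words Ww.
have [L LP] : exists L : seq 'End(V), forall m, (m <= n)%N -> forall u, words D m u -> u \in L.
  have [Lf LfP] := choice (@words_finite R V S D).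
  exists (flatten [seq Lf m | m <- iota 0 n.+1]) => m mn u um.
  apply/flattenP; exists (Lf m); last exact: LfP.
  by apply/mapP; exists m => //; rewrite mem_iota.
exists L => u Wu uv.
have [a c rac ap av _|m mn um] := stabilizer_words Kv wn Wu uv; last exact: LP mn _ um.
rewrite lt_def eq_sym (root_chamber_neq0 hD Kp rac Ww) /= leNgt; apply/negP => aw.
have := positive_on_chamber hD Kp rac Ww aw Kk; rewrite kE.
by rewrite functionalD functionalZ functionalB av; nra.
Qed.

(** Generators of the coroot cone of a point of K; there are finitely many of
    them if the stabilizer is finite. *)
Definition stabilizer_coroots v : set V :=
  [set c | exists u s, [/\ W u, u v = v, 0 < (alpha s v : R) & c = u (check s)]].

Lemma coroot_scale a c v : is_coroot D a c -> 0 < (a v : R) ->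
  c = (a v : R)^-1 *: (v - reflection a c v).
Proof.
move=> rac av; rewrite reflectionE opprB addrC subrK scalerA mulVf ?gt_eqF //.
by rewrite scale1r.
Qed.

(** Each coroot of a root positive at v is a multiple of a difference v - r v,
    which [orbit_sub_cone] places in the smaller cone. *)
Lemma coroot_coneE v : K v -> C_ v = cone_hull (stabilizer_coroots v).
Proof.
move=> Kv; have cc := cone_hull_cone (stabilizer_coroots v).
apply/seteqP; split; apply: cone_hull_min => //.
- move=> c [a [_ rac av]]; rewrite (coroot_scale rac av).
  case: (cc) => _ _ CZ; apply: CZ; first by rewrite invr_ge0 ltW.
  apply: (orbit_sub_cone hD Kp) => //; first exact: reflection_W rac.
    move=> s sv; apply: cone_hull_sub; exists \1%VF, s.
    by rewrite !id_lfunE; split=> //; exact: W_one.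
  move=> s sv; have rv : r s v = v by exact: reflection_fix.
  apply: cone_hull_min; first exact: convex_cone_preimage.
  move=> _ [u [t [Wu uv tv ->]]]; apply: cone_hull_sub.
  exists (r s \o u)%VF, t; rewrite !comp_lfunE uv; split=> //.
  by apply: W_comp => //; exact: W_refl.
- exact: cone_hull_cone.
- move=> _ [u [s [Wu uv sv ->]]].
  apply: coroot_cone_mem (coroot_act Wu (coroot_simple D s)) _.
  by rewrite -[v in dual_act _ _ v]uv (dual_act_apply _ _ Wu).
Qed.

Lemma stabilizer_coroots_finite v : K v -> vinterior T v ->
  exists l : seq V, forall c, stabilizer_coroots v c -> c \in l.
Proof.
move=> Kv /(stabilizer_finite Kv)[l lP].
exists [seq (u : 'End(V)) (check s) | u <- l, s <- enum S] => _ [u [s [Wu uv _ ->]]].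
by apply/allpairsP; exists (u, s); rewrite lP ?mem_enum.
Qed.

Lemma coroot_cone_closed v : vinterior T v -> vclosed (C_ v).
Proof.
move=> Tv; have [u Wu [k Kk uk]] := vinterior_sub Tv.
have Tk : vinterior T k.
  by rewrite -(W_cancel Wu k) uk; apply: interior_tits_act => //; exact: W_inv.
have [l lP] := stabilizer_coroots_finite Kk Tk.
have clk : vclosed (C_ k) by rewrite coroot_coneE //; exact: finite_cone_closed lP.
have -> : C_ v = [set c | C_ k (0 + (u^-1)%VF c)].
  apply/seteqP; split=> c /=; rewrite add0r => Cc.
    by rewrite -(W_cancel Wu k) uk; apply: coroot_cone_act => //; exact: W_inv.
  by rewrite -(W_cancelV Wu c) -uk; exact: coroot_cone_act.
exact: (@vclosed_preimage R V V (u^-1)%VF 0 (C_ k)).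
Qed.

(** A root positive at k is positive at p, and its coroot is then a multiple
    of a difference p - r p. *)
Lemma coroot_cone_sub_simple k : K k -> C_ k `<=` C_S.
Proof.
move=> Kk; apply: cone_hull_min; first exact: cone_hull_cone.
move=> c [a [_ rac ak]].
have ap : 0 < (a p : R).
  rewrite lt_def (root_neq0 hD rac Kp) leNgt; apply: contraTN ak => ap.
  by rewrite -leNgt (negative_root_le0 hD Kp rac ap Kk).
rewrite (coroot_scale rac ap).
case: (cone_hull_cone (range check)) => _ _ CZ; apply: CZ.
  by rewrite invr_ge0 ltW.
apply: (orbit_sub_cone hD Kp) => //.
- exact: cone_hull_cone.
- exact: open_chamber_sub.
- exact: reflection_W rac.
- by move=> s _; apply: cone_hull_sub; exists s.
- by move=> s sp; have := Kp s; rewrite sp ltxx.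
Qed.

Lemma simple_cone_closed : vclosed C_S.
Proof.
apply: (@finite_cone_closed R V _ [seq check s | s <- enum S]) => _ [s _ <-].
by rewrite map_f ?mem_enum.
Qed.

(** Intersecting the stabilizer translates of the cone of simple coroots
    leaves only the coroot cone: a half-space containing the latter can be
    moved by the finite stabilizer of k so as to contain the former. *)
Lemma simple_cone_intersection k x : K k -> vinterior T k ->
  (forall u, W u -> u k = k -> C_S (k - u x)) -> C_ k (k - x).
Proof.
move=> Kk Tk kx; apply: contrapT; rewrite coroot_coneE //.
have [l lP] := stabilizer_coroots_finite Kk Tk.
move=> /(finite_cone_separation lP)[f fpos fneg].
have [L LP] := stabilizer_finite Kk Tk.
(* Replacing f by f o u with u in the stabilizer makes it nonnegative on the
   simple coroots of the walls through k as well. *)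
have [|u [[Wu uk] umax]] := @maximum_on_seq R _ L (fun u : 'End(V) => W u /\ u k = k)
    (fun u : 'End(V) => f (u p) : R).
  exists \1%VF; last by split; [exact: W_one|rewrite id_lfunE].
  by apply: LP; [exact: W_one|rewrite id_lfunE].
suff fu : C_S `<=` [set c | 0 <= ((f \o u)%VF c : R)].
  have Wu' := W_inv Wu.
  have u'k : (u^-1)%VF k = k by rewrite -[k in LHS]uk (W_cancel Wu).
  have := fu _ (kx _ Wu' u'k); rewrite /= comp_lfunE linearB /= uk (W_cancelV Wu).
  by rewrite leNgt fneg.
apply: cone_hull_min; first exact: convex_cone_halfspace.
move=> _ [s _ <-] /=; rewrite comp_lfunE.
have := Kk s; rewrite le_eqVlt => /orP[/eqP/esym sk|sk]; last first.
  by apply: fpos; exists u, s.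
have Wur : W (u \o r s)%VF by apply: W_comp => //; exact: W_refl.
have urk : (u \o r s)%VF k = k by rewrite comp_lfunE [r s k]reflection_fix.
have := umax _ (LP _ Wur urk) (conj Wur urk).
rewrite comp_lfunE [r s p]reflectionE linearB linearZ /= functionalB functionalZ.
by rewrite gerBl pmulr_rge0 //; exact: Kp.
Qed.

(** Both sides are invariant under W, so that for the second inclusion v and x
    may be moved into K. *)
Lemma orbit_hull_tits v : T v ->
  co v `&` T = T `&` bigcap_translates D v (vclosure (C_ v)).
Proof.
move=> Tv; apply/seteqP; split=> x.
  move=> [cox Tx]; split=> // w Ww.
  exists (v - (w^-1)%VF x); last by rewrite subKr (W_cancelV Ww).
  apply: hull_sub_translate (orbit_hull_act (W_inv Ww) cox).
  - exact/convex_cone_closure/cone_hull_cone.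
  - exact: closed_vclosure.
  - by move=> u Wu; apply: sub_vclosure; exact: orbit_coroot_cone.
move=> [Tx xv]; split=> //; have [w Ww [x0 Kx0 xE]] := Tx.
have [u Wu [k Kk vE]] := Tv.
rewrite -vE (orbit_hull_orbit _ Wu) -xE; apply: orbit_hull_act => //.
apply: (dominated_in_hull hD Kp Kk Kx0).
have Wu' := W_inv Wu.
have [c Cc cE] := xv (w \o u^-1)%VF (W_comp Ww Wu').
have -> : k - x0 = (u^-1)%VF c.
  rewrite -(W_cancel Ww x0) xE -cE comp_lfunE (W_cancel Ww) linearB -vE /=.
  by rewrite (W_cancel Wu) subKr.
by rewrite -{1}(W_cancel Wu k) vE; exact: closed_coroot_cone_act.
Qed.

Lemma orbit_hull_simple k : K k -> vinterior T k -> co k `<=` T ->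
  co k = T `&` bigcap_translates D k C_S.
Proof.
move=> Kk Tk coT; apply/seteqP; split=> x.
  move=> cox; split; first exact: coT.
  move=> w Ww; exists (k - (w^-1)%VF x); last by rewrite subKr (W_cancelV Ww).
  apply: hull_sub_translate (orbit_hull_act (W_inv Ww) cox).
  - exact: cone_hull_cone.
  - exact: simple_cone_closed.
  - move=> u Wu; apply: (coroot_cone_sub_simple Kk).
    exact: orbit_coroot_cone (chamber_sub_tits Kk) Wu.
move=> [[w Ww [x0 Kx0 <-]] xk]; apply: orbit_hull_act => //.
apply: (dominated_in_hull hD Kp Kk Kx0); apply: sub_vclosure.
apply: simple_cone_intersection => // u Wu uk.
have [c Cc cE] := xk (w \o u^-1)%VF (W_comp Ww (W_inv Wu)).
suff -> : k - u x0 = c by [].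
rewrite -(W_cancel Ww x0) -cE comp_lfunE (W_cancel Ww) (W_cancelV Wu).
by rewrite subKr.
Qed.

End TitsCone.

(** * The hull of an interior orbit is interior *)

Section Barrier.
Variables (R : realType) (V : vectType R) (S : finType) (D : reflection_data V S).
Local Notation W := (W D).
Local Notation K := (K D).
Local Notation co := (orbit_hull D).
Local Notation T := (tits_cone D).
Implicit Types (w u : 'End(V)) (x y z v k : V) (f g h : 'Hom(V, R^o)).

(** Since v + e x and v - e' x lie in T for small e, e' > 0. *)
Lemma nonnegative_dominated v x : vinterior T v ->
  exists N : R, 0 <= N /\ forall h, (forall z, T z -> 0 <= (h z : R)) ->
    `|h x : R| <= N * (h v : R).
Proof.
move=> Tv; have [e e0 Te] := interior_feasible x Tv.
have [e' e'0 Te'] := interior_feasible (- x) Tv.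
exists (e^-1 + e'^-1); split; first by rewrite addr_ge0 // invr_ge0 ltW.
move=> h hT; have hv : 0 <= (h v : R) by exact: hT _ (vinterior_sub Tv).
have := hT _ Te; have := hT _ Te'; rewrite !functionalD !functionalZ functionalN mulrN.
move=> h1 h2.
have b1 : (h x : R) <= e'^-1 * (h v : R) by rewrite mulrC ler_pdivlMr //; lra.
have b2 : - (h x : R) <= e^-1 * (h v : R) by rewrite mulrC ler_pdivlMr //; lra.
have p1 : 0 <= e'^-1 * (h v : R) by rewrite mulr_ge0 // invr_ge0 ltW.
have p2 : 0 <= e^-1 * (h v : R) by rewrite mulr_ge0 // invr_ge0 ltW.
by rewrite ler_norml; lra.
Qed.

Lemma functional_coordinates h :
  h = \sum_(i < \dim {:V}) (h ((vbasis {:V})`_i) : R) *: linfun (coord (vbasis {:V}) i : V -> R^o).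
Proof.
apply/lfunP => x; rewrite {1}(cnorm_coord x) functional_sum functional_sumE.
by apply: eq_bigr => i _; rewrite functionalZ functional_scaleE lfunE /= mulrC.
Qed.

Lemma nonnegative_functional_dominated v (phi : 'Hom('Hom(V, R^o), R^o)) :
  vinterior T v ->
  exists N : R, 0 <= N /\ forall h, (forall z, T z -> 0 <= (h z : R)) ->
    `|phi h : R| <= N * (h v : R).
Proof.
move=> Tv.
have [N NP] := choice (fun i : 'I_(\dim {:V}) => nonnegative_dominated ((vbasis {:V})`_i) Tv).
exists (\sum_i N i * `|phi (linfun (coord (vbasis {:V}) i : V -> R^o)) : R|); split.
  by apply: sumr_ge0 => i _; rewrite mulr_ge0 //; case: (NP i).
move=> h hT; rewrite {1}(functional_coordinates h) functional_sum.
rewrite (le_trans (ler_norm_sum _ _ _)) // mulr_suml; apply: ler_sum => i _.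
rewrite functionalZ normrM mulrAC ler_wpM2r //.
by have [_] := NP i; apply.
Qed.

Section OrbitOfFunctional.
Variable f : 'Hom(V, R^o).
Let X : set 'Hom(V, R^o) := [set g | exists2 w, W w & g = (f \o w)%VF].
Variable l : seq 'Hom(V, R^o).
Hypotheses (freel : free l) (lX : forall g, g \in l -> X g)
  (Xl : forall g, X g -> g \in << l >>%VS).

Let m := size l.
(** Matrix of the action of w on the span of the orbit of f, in the basis l. *)
Let orbit_matrix w : 'M[R]_m :=
  \matrix_(i, j) coord (in_tuple l) j (l`_i \o w)%VF.

Lemma orbit_matrix_comp w u : W w -> 
  orbit_matrix (w \o u)%VF = orbit_matrix w *m orbit_matrix u.
Proof.
move=> Ww; apply/matrixP => i k; rewrite !mxE.
have wX : (l`_i \o w)%VF \in << in_tuple l >>%VS.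
  have [|w' Ww' ->] := @lX l`_i; first by rewrite mem_nth.
  apply: Xl; exists (w' \o w)%VF; first exact: W_comp.
  by rewrite comp_lfunA.
have -> : (l`_i \o (w \o u) = \sum_(j < m) coord (in_tuple l) j (l`_i \o w) *: (l`_j \o u))%VF.
  apply/lfunP => x; rewrite comp_lfunA comp_lfunE {1}(coord_span wX) !sum_lfunE.
  by apply: eq_bigr => j _; rewrite !scale_lfunE comp_lfunE.
by rewrite linear_sum; apply: eq_bigr => j _; rewrite !mxE linearZ.
Qed.

Lemma orbit_matrix1 : orbit_matrix \1%VF = 1%:M.
Proof.
by apply/matrixP => i j; rewrite !mxE comp_lfun1r (coord_free (X := in_tuple l)).
Qed.

(** Reflections have determinant 1 or -1 on every invariant subspace. *)
Lemma det_orbit_matrix w : W w -> `|\det (orbit_matrix w)| = 1.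
Proof.
have unit (x y : R) : `|x * y| = 1 -> `|x| = 1 -> `|y| = 1.
  by rewrite normrM => + x1; rewrite x1 mul1r.
elim=> [|s|u1 u2 Wu1 d1 _ d2|u Wu du].
- by rewrite orbit_matrix1 det1 normr1.
- have : (\det (orbit_matrix (srefl D s))) ^+ 2 = 1.
    rewrite expr2 -det_mulmx -orbit_matrix_comp; last exact: W_refl.
    rewrite [X in orbit_matrix X](_ : _ = \1%VF) ?orbit_matrix1 ?det1 //.
    by apply/lfunP => x; rewrite comp_lfunE srefl_involutive id_lfunE.
  by move/eqP; rewrite sqrf_eq1 => /orP[] /eqP ->; rewrite ?normrN1 ?normr1.
- by rewrite orbit_matrix_comp // det_mulmx normrM d1 d2 mulr1.
- apply: (unit (\det (orbit_matrix u))) => //.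
  rewrite -det_mulmx -orbit_matrix_comp //.
  rewrite [X in orbit_matrix X](_ : _ = \1%VF) ?orbit_matrix1 ?det1 ?normr1 //.
  by apply/lfunP => x; rewrite comp_lfunE (W_cancelV Wu) id_lfunE.
Qed.

Hypothesis fT : forall z, T z -> 0 <= (f z : R).

Lemma orbit_functional_ge0 g z : g \in l -> T z -> 0 <= (g z : R).
Proof.
by move=> /lX[w Ww ->] Tz; rewrite comp_lfunE; apply: fT; exact: tits_act.
Qed.

(** The functionals l_i o w are nonnegative on T, so their coordinates are
    bounded by a multiple of their values at the interior point v. By the
    Leibniz formula so is the determinant, which has absolute value 1. *)
Lemma orbit_product_bounded v : vinterior T v ->
  exists2 c : R, 0 < c & forall w, W w -> c <= \prod_(i < m) (l`_i (w v) : R).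
Proof.
move=> Tv.
have [N NP] := choice (fun j : 'I_m => nonnegative_functional_dominated
  (linfun (coord (in_tuple l) j : 'Hom(V, R^o) -> R^o)) Tv).
have N0 j : 0 <= N j by case: (NP j).
pose M := 1 + \sum_j N j.
have M0 : 0 < M by rewrite ltr_pwDl // sumr_ge0.
have NM j : N j <= M.
  by rewrite /M (bigD1 j) //= addrCA lerDl addr_ge0 // sumr_ge0.
pose c := (#|{: 'S_m}|%:R * M ^+ m)^-1.
have c0 : 0 < c.
  rewrite invr_gt0 mulr_gt0 ?exprn_gt0 // ltr0n; apply/card_gt0P.
  by exists (perm_one _).
exists c => // w Ww.
have Awv i j : `|orbit_matrix w i j| <= M * (l`_i (w v) : R).
  have lwT z : T z -> 0 <= ((l`_i \o w)%VF z : R).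
    move=> Tz; rewrite comp_lfunE; apply: orbit_functional_ge0; rewrite ?mem_nth //.
    exact: tits_act.
  rewrite mxE; have := (NP j).2 _ lwT; rewrite lfunE /= comp_lfunE => b.
  apply: (le_trans b); rewrite ler_wpM2r // -comp_lfunE lwT //.
  exact: vinterior_sub.
rewrite /c -[X in X <= _]mul1r ler_pdivrMr; last by rewrite -invr_gt0.
rewrite -[leLHS](det_orbit_matrix Ww) (le_trans (ler_norm_sum _ _ _)) //.
rewrite mulrCA mulr_natl -sumr_const.
rewrite [X in _ <= X](eq_bigl xpredT); last by move=> s.
apply: ler_sum => s _; rewrite normrM normrX normrN normr1 expr1n mul1r normr_prod.
rewrite mulrC -[m in M ^+ m]card_ord -prodr_const -big_split /=.
by apply: ler_prod => i _; rewrite normr_ge0 Awv.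
Qed.

(** For nonnegative weights t_i with product 1, the sum of the t_i l_i is at
    least the m-th root of the product of the l_i, hence bounded below on the
    orbit independently of the weights; being linear, it has the same bound on
    the hull. If g vanished or were negative at y, a huge weight on g and
    small ones on the other functionals would contradict the bound. *)
Lemma orbit_functional_positive v y g : g \in l -> vinterior T v -> co v y ->
  0 < (g y : R).
Proof.
move=> gl Tv coy; rewrite ltNge; apply/negP => gy.
have [c c0 cP] := orbit_product_bounded Tv.
have gi : (index g l < m)%N by rewrite index_mem.
pose i0 := Ordinal gi.
have gE : l`_i0 = g by rewrite nth_index.
(* Weights of product 1 for which g dominates as s grows. *)
pose t (s : R) (i : 'I_m) := if i == i0 then s ^+ m.-1 else s^-1.
have t0 s i : 0 < s -> 0 <= t s i.
  by move=> s0; rewrite /t; case: ifP => _; rewrite ?exprn_ge0 ?invr_ge0 // ltW.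
have tprod s : 0 < s -> \prod_i t s i = 1.
  move=> s0; rewrite (bigD1 i0) //= /t eqxx.
  rewrite (eq_bigr (fun=> s^-1)) => [|i /negPf -> //].
  rewrite prodr_const cardC1 card_ord exprVn mulfV // expf_neq0 //.
  by rewrite gt_eqF.
pose phi s := \sum_i t s i *: l`_i.
have phiE s x : (phi s x : R) = \sum_i t s i * (l`_i x : R).
  by rewrite functional_sumE; apply: eq_bigr => i _; rewrite functional_scaleE.
pose kap := Num.min 1 c.
have kap0 : 0 < kap by rewrite lt_min ltr01.
have phi_orbit s w : 0 < s -> W w -> kap <= (phi s (w v) : R).
  move=> s0 Ww; rewrite leNgt; apply/negP; rewrite lt_min => /andP[phi1 phic].
  have ti i : 0 <= t s i * (l`_i (w v) : R).
    rewrite mulr_ge0 ?t0 // orbit_functional_ge0 ?mem_nth //.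
    exact: tits_act Ww (vinterior_sub Tv).
  have phi0 : 0 <= (phi s (w v) : R) by rewrite phiE sumr_ge0.
  have := cP w Ww; have <- : \prod_i (t s i * (l`_i (w v) : R)) = \prod_(i < m) (l`_i (w v) : R).
    by rewrite big_split /= tprod ?mul1r.
  rewrite leNgt; case/negP; apply: le_lt_trans phic.
  apply: (@le_trans _ _ ((phi s (w v) : R) ^+ m)).
    rewrite -[m in _ ^+ m]card_ord -prodr_const; apply: ler_prod => i _.
    by rewrite ti phiE (bigD1 i) //= lerDl sumr_ge0.
  rewrite -[m in _ ^+ m](ltn_predK gi) exprS ler_piMr //.
  by rewrite exprn_ile1 // ltW.
have phi_y s : 0 < s -> kap <= (phi s y : R).
  move=> s0; have : co v `<=` [set x | kap <= (phi s x : R)].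
    apply: hull_min; [exact: vclosed_le|exact: convex_halfspace|].
    by move=> _ [w Ww <-]; exact: phi_orbit.
  exact.
pose B := \sum_(i | i != i0) `|l`_i y : R|.
have B0 : 0 <= B by exact: sumr_ge0.
have s0 : 0 < (B + 1) / kap by rewrite divr_gt0 // ltr_wpDl.
have := phi_y _ s0; rewrite phiE (bigD1 i0) //= leNgt; case/negP.
apply: (@le_lt_trans _ _ (((B + 1) / kap)^-1 * B)); last first.
  by rewrite invf_div mulrAC ltr_pdivrMr ?ltr_wpDl // ltr_pM2l // ltrDl.
rewrite -[X in _ <= X]add0r lerD //.
  by rewrite gE /t eqxx mulr_ge0_le0 // exprn_ge0 // ltW.
rewrite /B mulr_sumr; apply: ler_sum => i /negPf ii0; rewrite /t ii0.
by rewrite ler_wpM2l ?invr_ge0 ?(ltW s0) // ler_norm.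
Qed.

End OrbitOfFunctional.

Hypothesis hD : linear_coxeter_system D.

Lemma interior_tits_add x y : T x -> vinterior T y -> vinterior T (x + y).
Proof.
have [p Kp] := open_chamber_nonempty hD; have [_ TD _] := tits_convex_cone hD Kp.
move=> Tx /vinteriorP[e e0 eT]; apply/vinteriorP; exists e => // z zxy.
by rewrite -(subrKC x z); apply: TD => //; apply: eT; rewrite -addrA -opprD.
Qed.

Lemma interior_tits_scale (s : R) x : 0 < s -> vinterior T x -> vinterior T (s *: x).
Proof.
have [p Kp] := open_chamber_nonempty hD; have [_ _ TZ] := tits_convex_cone hD Kp.
move=> s0 /vinteriorP[e e0 eT]; apply/vinteriorP.
exists (s * e); first exact: mulr_gt0.
move=> z zx; rewrite -[z](scalerK (a := s^-1)) ?invr_eq0 ?gt_eqF // invrK.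
apply: TZ; first exact: ltW.
apply: eT; rewrite -[X in _ - X](scalerK (a := s)) ?gt_eqF // -scalerBr cnormZ.
by rewrite ger0_norm ?invr_ge0 ?(ltW s0) // mulrC ltr_pdivrMr // mulrC.
Qed.

(** The extension theorem of M. Riesz applies to the convex cone T - R_+ y,
    with an interior point p of T as order unit: were - p in this cone, y
    would be interior to T. *)
Lemma support_functional y : ~ vinterior T y ->
  exists f : 'Hom(V, R^o), [/\ f != 0, forall z, T z -> 0 <= (f z : R) & (f y : R) <= 0].
Proof.
have [p Kp] := open_chamber_nonempty hD; have [T0 TD TZ] := tits_convex_cone hD Kp.
have Tp : vinterior T p.
  have /vinteriorP[e e0 eK] : vinterior K p by rewrite interior_chamberE.
  by apply/vinteriorP; exists e => // x /eK/chamber_sub_tits.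
move=> nTy.
(* The cone spanned by T and - y: a functional nonnegative on it is nonpositive
   at y. *)
pose C := [set x | exists z (s : R), [/\ T z, 0 <= s & x = z - s *: y]].
have CC : convex_cone C.
  split.
  - by exists 0, 0; rewrite scale0r subr0.
  - move=> _ _ [x [s [Tx s0 ->]]] [z [q [Tz q0 ->]]].
    exists (x + z), (s + q); split; [exact: TD|exact: addr_ge0|].
    by rewrite scalerDl opprD addrACA.
  - move=> k _ k0 [x [s [Tx s0 ->]]]; exists (k *: x), (k * s); split.
    + exact: TZ.
    + exact: mulr_ge0.
    + by rewrite scalerBr scalerA.
have Cp : ~ C (- p).
  move=> [z [s [Tz s0 E]]].
  have syE : s *: y = z + p by rewrite -[p]opprK E opprB subrKC.
  have := interior_tits_add Tz Tp; rewrite -syE.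
  move: s0; rewrite le_eqVlt => /orP[/eqP <-|s0] Tsy.
    apply: nTy; apply/vinteriorP; exists 1 => // x _.
    have [e e0] := interior_feasible x Tsy; rewrite scale0r add0r => Tex.
    rewrite -[x](scalerK (a := e)) ?gt_eqF //; apply: TZ => //.
    by rewrite invr_ge0 ltW.
  apply: nTy; rewrite -[y](scalerK (a := s)) ?gt_eqF //.
  by apply: interior_tits_scale; rewrite ?invr_gt0.
have [|f fp fC] := riesz_extension CC Cp.
  move=> x; have [e e0 Tex] := interior_feasible x Tp.
  exists e^-1; first by rewrite invr_ge0 ltW.
  exists (e^-1 *: (p + e *: x)), 0; split => //.
    by apply: TZ => //; rewrite invr_ge0 ltW.
  by rewrite scale0r subr0 scalerDr scalerK ?gt_eqF.
exists f; split.
- by apply/eqP => f0; move: fp; rewrite f0 zero_lfunE => /esym/eqP; rewrite oner_eq0.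
- by move=> z Tz; apply: fC; exists z, 0; rewrite scale0r subr0.
- rewrite -oppr_ge0 -functionalN; apply: fC; exists 0, 1.
  by rewrite scale1r sub0r.
Qed.

(** A functional nonnegative on T and nonpositive at a point of the hull would
    contradict [orbit_functional_positive]. *)
Lemma orbit_hull_interior v : vinterior T v -> co v `<=` vinterior T.
Proof.
move=> Tv y coy; apply: contrapT => /support_functional[f [f0 fT fy]].
pose X : set 'Hom(V, R^o) := [set g | exists2 w, W w & g = (f \o w)%VF].
have Xf : X f by exists \1%VF; [exact: W_one|rewrite comp_lfun1r].
have [||l [freel fl lX Xl]] := @free_subset_span R _ X [:: f].
- by rewrite seq1_free.
- by move=> g; rewrite inE => /eqP ->.
have := orbit_functional_positive freel lX Xl fT (fl f _) Tv coy.
by rewrite inE eqxx => /(_ isT); rewrite ltNge fy.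
Qed.

End Barrier.

(* In the last clause C_S belongs to the chamber K, so the formula is about
   the points of the orbit of v that lie in K; for v in K take u = 1. *)
Theorem theorem2p25 (R : realType) (V : vectType R) (S : finType)
    (D : reflection_data V S) (hD : linear_coxeter_system D)
    (v : V) (hv : tits_cone D v) :
  orbit_hull D v `&` tits_cone D =
    tits_cone D `&` bigcap_translates D v (vclosure (coroot_cone D v))
  /\
  (vinterior (tits_cone D) v ->
   [/\ vclosed (coroot_cone D v),
       orbit_hull D v `<=` vinterior (tits_cone D),
       orbit_hull D v =
         tits_cone D `&` bigcap_translates D v (coroot_cone D v)
     & forall u : 'End(V), W D u -> K D (u v) ->
       orbit_hull D v =
         tits_cone D `&` bigcap_translates D (u v) (simple_coroot_cone D)]).
Proof.
have [p Kp] := open_chamber_nonempty hD.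
have hullT := orbit_hull_tits hD Kp hv.
split=> // intv.
have clC := coroot_cone_closed hD Kp intv.
have coT := orbit_hull_interior hD intv.
split=> //.
  rewrite -[in RHS](vclosed_id clC) -hullT setIidl //.
  by move=> x /coT/vinterior_sub.
move=> u Wu Kuv; rewrite -(orbit_hull_orbit v Wu).
apply: (orbit_hull_simple hD Kp Kuv); first exact: interior_tits_act.
by rewrite (orbit_hull_orbit v Wu) => x /coT/vinterior_sub.
Qed.
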